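(* Let $M$ and $\widehat M$ be connected, oriented Riemannian manifolds of dimension $n\ge 2$. Let $x\colon[0,\tau]\to M$ and $\widehat x\colon[0,\tau]\to\widehat M$ be two $C^n$ curves, parametrized by arc-length, that are also $C^{n-1}$-regular. Then there is a rolling $q(t)$ of $M$ on $\widehat M$ such that $\pi q(t)=x(t)$ and $\widehat\pi q(t)=\widehat x(t)$ for all $t\in[0,\tau]$ if and only if $\kappa_j=\widehat\kappa_j$ for $j=1,\dots,n-1$, where $\kappa_j$ and $\widehat\kappa_j$ are the geodesic curvatures of $x(t)$ and $\widehat x(t)$ respectively.
   Context: Rolling. Let $M,\widehat M$ be connected, oriented Riemannian manifolds of the same dimension $n$. Let $Q=\{q\in \mathrm{SO}(T_xM,T_{\widehat x}\widehat M): x\in M,\ \widehat x\in\widehat M\}$, where $\mathrm{SO}(V,W)$ is the set of orientation preserving linear isometries between oriented inner product spaces $V$ and $W$; $Q$ is a smooth fiber bundle over $M\times\widehat M$, with projections $\pi\colon Q\to M$, $\widehat\pi\colon Q\to\widehat M$. A rolling (without slipping or twisting) of $M$ on $\widehat M$ is an absolutely continuous curve $q\colon[0,\tau]\to Q$ such that, with $x(t)=\pi q(t)$ and $\widehat x(t)=\widehat\pi q(t)$: (I) no slip: $\dot{\widehat x}(t)=q(t)\dot x(t)$ for almost all $t$; (II) no twist: $q(t)\frac{D}{dt}Z(t)=\frac{D}{dt}\big(q(t)Z(t)\big)$ for almost every $t$, for every (absolutely continuous) vector field $Z(t)$ along $x(t)$. Here $\frac{D}{dt}$ is the covariant derivative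 along the curve for the Levi-Civita connection of the respective manifold. Regularity. For $1\le k\le n$, a (sufficiently differentiable) curve $x(t)$ is $C^k$-regular if the $k$ vectors $\dot x(t),\frac{D}{dt}\dot x(t),\dots,\frac{D^{k-1}}{dt^{k-1}}\dot x(t)$ are linearly independent for every $t$. Frenet vector fields and geodesic curvatures. Let $x(t)$ be a $C^n$, $C^{n-1}$-regular curve parametrized by arc-length in an oriented $n$-dimensional Riemannian manifold. Put $v_1=\dot x$, $\kappa_0=0$, $v_0=0$. Inductively, for $1\le j\le n-2$, put $\kappa_j(t)=\left|\frac{D}{dt}v_j(t)+\kappa_{j-1}(t)v_{j-1}(t)\right|$ (which never vanishes, by regularity) and let $v_{j+1}$ be the unit vector field along $x$ with $\frac{D}{dt}v_j+\kappa_{j-1}v_{j-1}=\kappa_jv_{j+1}$. Then $v_1,\dots,v_{n-1}$ are orthonormal. Let $v_n(t)$ be the unique unit vector field such that $v_1(t),\dots,v_n(t)$ is a positively oriented orthonormal basis for every $t$, and put $\kappa_{n-1}(t)=\left\langle v_n(t),\frac{D}{dt}v_{n-1}(t)+\kappa_{n-2}(t)v_{n-2}(t)\right\rangle$ (which may have any sign). The $v_j$ are the Frenet vector fields and the $\kappa_j$ ($1\le j\le n-1$) the geodesic curvatures of $x$. *)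

(* Defs.v *)
From HB Require Import structures.
From mathcomp Require Import all_boot all_order all_algebra.
From mathcomp Require Import all_classical all_reals all_analysis.

Set Implicit Arguments.
Unset Strict Implicit.
Unset Printing Implicit Defensive.
Import Order.TTheory GRing.Theory Num.Theory numFieldNormedType.Exports.

Local Open Scope classical_set_scope.
Local Open Scope ring_scope.

(** * Regularity of functions between normed spaces *)

(** [C^k] on a set [A] that is meant to be open. *)
Fixpoint Ck_on {R : realType} {V W : normedModType R} (k : nat) (A : set V)
    (f : V -> W) : Prop :=
  if k is k'.+1 then
    (forall u, A u -> differentiable f u) /\ (forall v, Ck_on k' A ('D_v f))
  else forall u, A u -> {for u, continuous f}.

Definition smooth_on {R : realType} {V W : normedModType R} (A : set V)
    (f : V -> W) : Prop := forall k, Ck_on k A f.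

(** Derivative relative to [A], hence one-sided at the end points of a compact
    interval [A]. *)
Definition is_deriv_in {R : realType} {V : normedModType R} (A : set R)
    (f : R -> V) (t : R) (l : V) : Prop :=
  (fun s => (s - t)^-1 *: (f s - f t)) @ within A t^' --> l.

(** [C^k] on a set [A] that is meant to be relatively open in a nondegenerate
    interval. *)
Fixpoint Ck_in {R : realType} {V : normedModType R} (k : nat) (A : set R)
    (f : R -> V) : Prop :=
  if k is k'.+1 then
    exists2 f' : R -> V,
      (forall t, A t -> is_deriv_in A f t (f' t)) & Ck_in k' A f'
  else {within A, continuous f}.

(** The finitely many intervals may be degenerate; those contribute nothing. *)
Definition abs_continuous {R : realType} {V : normedModType R} (a b : R)
    (f : R -> V) : Prop :=
  forall e : R, 0 < e -> exists2 d : R, 0 < d &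
    forall (m : nat) (l r : 'I_m -> R),
      (forall k, [/\ a <= l k, l k <= r k & r k <= b]) ->
      (forall k k', k != k' -> r k <= l k' \/ r k' <= l k) ->
      \sum_(k < m) (r k - l k) < d ->
      \sum_(k < m) `|f (r k) - f (l k)| < e.

(** * Oriented Riemannian manifolds

    The smooth structure and the orientation are given by an atlas whose
    transition maps are smooth with positive Jacobian determinant.  Vectors of
    coordinates are rows, so that a linear map acts as [v *m J]. *)
Record oriented_riemannian (R : realType) (n : nat) := OrientedRiemannian {
  carrier :> topologicalType ;
  carrier_hausdorff : hausdorff_space carrier ;
  carrier_second_countable : @second_countable carrier ;
  chart : Type ;
  chart_dom : chart -> set carrier ;
  chart_map : chart -> carrier -> 'rV[R]_n ;
  chart_inv : chart -> 'rV[R]_n -> carrier ;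
  chart_cover : forall x, exists i, chart_dom i x ;
  chart_dom_open : forall i, open (chart_dom i) ;
  chart_map_open : forall i, open (chart_map i @` chart_dom i) ;
  chart_mapK : forall i x, chart_dom i x -> chart_inv i (chart_map i x) = x ;
  chart_map_continuous : forall i x, chart_dom i x ->
    {for x, continuous (chart_map i)} ;
  chart_inv_continuous : forall i u, (chart_map i @` chart_dom i) u ->
    {for u, continuous (chart_inv i)} ;
  transition_smooth : forall i j,
    smooth_on (chart_map i @` (chart_dom i `&` chart_dom j))
      (chart_map j \o chart_inv i) ;
  transition_oriented : forall i j x, chart_dom i x -> chart_dom j x ->
    0 < \det (jacobian (chart_map j \o chart_inv i) (chart_map i x)) ;
  (** Gram matrix of the coordinate frame, as a function of the coordinates *)
  metric : chart -> 'rV[R]_n -> 'M[R]_n ;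
  metric_smooth : forall i, smooth_on (chart_map i @` chart_dom i) (metric i) ;
  metric_sym : forall i x, chart_dom i x ->
    (metric i (chart_map i x))^T = metric i (chart_map i x) ;
  metric_pos : forall i x (v : 'rV[R]_n), chart_dom i x -> v != 0 ->
    0 < (v *m metric i (chart_map i x) *m v^T) 0 0 ;
  metric_transition : forall i j x, chart_dom i x -> chart_dom j x ->
    let J := jacobian (chart_map j \o chart_inv i) (chart_map i x) in
    metric i (chart_map i x) = J *m metric j (chart_map j x) *m J^T
}.

Section Tangent.
Context {R : realType} {n : nat} {M : oriented_riemannian R n}.
Implicit Types (x : M) (i j : chart M).

Definition chart_at x : chart M := projT1 (cid (chart_cover x)).

(** A tangent vector at [x] is the family of its coordinates in all charts
    around [x]; the value in the other charts is [0] by convention. *)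
Definition tangent_family x : set (chart M -> 'rV[R]_n) := [set v |
  (forall i, ~ chart_dom i x -> v i = 0) /\
  (forall i j, chart_dom i x -> chart_dom j x ->
     v j = v i *m jacobian (chart_map j \o chart_inv i) (chart_map i x))].

Definition tangent_pred x : {pred chart M -> 'rV[R]_n} :=
  fun v => `[< tangent_family x v >].

Lemma tangent_pred_submod x : submod_closed (tangent_pred x).
Proof.
split.
  by apply/asboolP; split=> [//|i j _ _]; rewrite !fctE mul0mx.
move=> a u v /asboolP[u0 uJ] /asboolP[v0 vJ]; apply/asboolP; split.
  move=> i xi; have -> : (a *: u + v) i = a *: u i + v i by [].
  by rewrite u0// v0// scaler0 addr0.
move=> i j xi xj; have E k : (a *: u + v) k = a *: u k + v k by [].
by rewrite !E (uJ i j)// (vJ i j)// mulmxDl scalemxAl.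
Qed.

HB.instance Definition _ x := GRing.isSubmodClosed.Build R
  (chart M -> 'rV[R]_n) (tangent_pred x) (tangent_pred_submod x).

Record tangent x := Tangent {
  tangent_val :> chart M -> 'rV[R]_n ;
  tangent_valP : tangent_val \in tangent_pred x }.

HB.instance Definition _ x := [isSub for @tangent_val x].
HB.instance Definition _ x := [Choice of tangent x by <:].
HB.instance Definition _ x := [SubChoice_isSubLmodule of tangent x by <:].

(** Independent of the chart by [metric_transition]. *)
Definition inner x (v w : tangent x) : R :=
  let i := chart_at x in (v i *m metric i (chart_map i x) *m (w i)^T) 0 0.

Definition tnorm x (v : tangent x) : R := Num.sqrt (inner v v).

Definition orthonormal_family x (b : 'I_n -> tangent x) : Prop :=
  forall k l, inner (b k) (b l) = (k == l)%:R.

(** For a family of [n] vectors this includes being a basis. *)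
Definition positively_oriented x (b : 'I_n -> tangent x) : Prop :=
  0 < \det (\matrix_(k < n) b k (chart_at x)).

Definition lin_independent x (k : nat) (b : 'I_k -> tangent x) : Prop :=
  forall c : 'I_k -> R, \sum_(l < k) c l *: b l = 0 -> forall l, c l = 0.

End Tangent.
Arguments tangent {R n M} x.

Section CovariantDerivative.
Context {R : realType} {n : nat} {M : oriented_riemannian R n}.

(** Christoffel symbol [Gamma^k_ab] of the Levi-Civita connection. *)
Definition christoffel (i : chart M) (u : 'rV[R]_n) (a b k : 'I_n) : R :=
  let partial c d e : R :=
    'D_(delta_mx 0 c) (fun y : 'rV[R]_n => metric i y d e) u in
  2^-1 * \sum_(l < n) invmx (metric i u) k l *
    (partial a b l + partial b a l - partial l a b).

Variable tau : R.
Implicit Types x : R -> M.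

Definition continuous_curve x : Prop := {within `[0, tau], continuous x}.

Definition Ck_curve (k : nat) x : Prop :=
  continuous_curve x /\
  forall i, Ck_in k (`[0, tau] `&` x @^-1` chart_dom i) (chart_map i \o x).

Definition ac_curve x : Prop :=
  continuous_curve x /\
  forall i a b, 0 <= a -> b <= tau ->
    (forall t, a <= t <= b -> chart_dom i (x t)) ->
    abs_continuous a b (chart_map i \o x).

Definition ac_field x (Z : forall t, tangent (x t)) : Prop :=
  forall i a b, 0 <= a -> b <= tau ->
    (forall t, a <= t <= b -> chart_dom i (x t)) ->
    abs_continuous a b (fun t => Z t i).

Definition is_velocity x (t : R) (w : tangent (x t)) : Prop :=
  forall i, chart_dom i (x t) ->
    is_deriv_in `[0, tau] (chart_map i \o x) t (w i).

(** Total: [0] where the curve is not differentiable. *)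
Definition velocity x (t : R) : tangent (x t) := xget 0 [set w | is_velocity w].

Definition is_covariant x (Z : forall t, tangent (x t)) (t : R)
    (w : tangent (x t)) : Prop :=
  forall i, chart_dom i (x t) ->
    exists2 dz : 'rV[R]_n, is_deriv_in `[0, tau] (fun s => Z s i) t dz &
      w i = dz + \row_(k < n) \sum_(a < n) \sum_(b < n)
        christoffel i (chart_map i (x t)) a b k *
        velocity x t i 0 a * Z t i 0 b.

(** The covariant derivative along the curve, made total in the same way. *)
Definition covariant x (Z : forall t, tangent (x t)) (t : R) : tangent (x t) :=
  xget 0 [set w | is_covariant Z w].

Definition arclength x : Prop :=
  forall t, t \in `[0, tau] -> tnorm (velocity x t) = 1.

Definition Ck_regular (k : nat) x : Prop :=
  forall t, t \in `[0, tau] ->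
    lin_independent (fun l : 'I_k => iter l (@covariant x) (velocity x) t).

(** [frenet x j] is the triple [(kappa_j, v_j, v_(j+1))], meaningful for
    [j <= n - 2]. *)
Fixpoint frenet x (j : nat) :
    (R -> R) * (forall t, tangent (x t)) * (forall t, tangent (x t)) :=
  if j is j'.+1 then
    let: (kappa, v, w) := frenet x j' in
    let u t := covariant w t + kappa t *: v t in
    (fun t => tnorm (u t), w, fun t => (tnorm (u t))^-1 *: u t)
  else (fun=> 0, fun=> 0, velocity x).

(** The family [v_1, ..., v_(n-1), w] at time [t]. *)
Definition frenet_basis x (t : R) (w : tangent (x t)) (k : 'I_n) :
    tangent (x t) :=
  if (k.+1 < n)%N then (frenet x k).2 t else w.

Definition frenet_last x (t : R) : tangent (x t) :=
  xget 0 [set w | orthonormal_family (frenet_basis w) /\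
                  positively_oriented (frenet_basis w)].

(** [kappa_j] for [1 <= j <= n - 1]; the last one is signed. *)
Definition geodesic_curvature x (j : nat) (t : R) : R :=
  if (j.+1 < n)%N then (frenet x j).1.1 t
  else let: (kappa, v, w) := frenet x n.-2 in
    inner (frenet_last x t) (covariant w t + kappa t *: v t).

End CovariantDerivative.

Section Rolling.
Context {R : realType} {n : nat} (M N : oriented_riemannian R n).

(** The total space of the bundle of orientation preserving isometries. *)
Record configuration := Configuration {
  base1 : M ;
  base2 : N ;
  iso_map : {linear tangent base1 -> tangent base2} ;
  iso_map_inner : forall v w, inner (iso_map v) (iso_map w) = inner v w ;
  iso_map_oriented : forall b : 'I_n -> tangent base1,
    positively_oriented b -> positively_oriented (iso_map \o b)
}.

(** [A] is the matrix of [q] in the coordinate frames of [i] and [j]. *)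
Definition iso_map_matrix (i : chart M) (j : chart N) (q : configuration)
    (A : 'M[R]_n) : Prop :=
  forall v : tangent (base1 q), iso_map q v j = v i *m A.

(** Local coordinates on the bundle are those of the two base points together
    with the matrix of the isometry in the coordinate frames. *)
Definition ac_configuration_curve (tau : R) (q : R -> configuration) : Prop :=
  [/\ ac_curve tau (fun t => base1 (q t)),
      ac_curve tau (fun t => base2 (q t)) &
      forall i j a b, 0 <= a -> b <= tau ->
        (forall t, a <= t <= b ->
          chart_dom i (base1 (q t)) /\ chart_dom j (base2 (q t))) ->
        exists2 A : R -> 'M[R]_n,
          (forall t, a <= t <= b -> iso_map_matrix i j (q t) (A t)) &
          abs_continuous a b A].

Definition no_slip (tau : R) (q : R -> configuration) : Prop :=
  {ae lebesgue_measure, forall t : R, t \in `[0, tau] ->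
    velocity tau (fun s => base2 (q s)) t =
    iso_map (q t) (velocity tau (fun s => base1 (q s)) t)}.

Definition no_twist (tau : R) (q : R -> configuration) : Prop :=
  forall Z : forall t, tangent (base1 (q t)), ac_field tau Z ->
  {ae lebesgue_measure, forall t : R, t \in `[0, tau] ->
    iso_map (q t) (covariant tau Z t) =
    @covariant R n N tau (fun s => base2 (q s))
      (fun s => iso_map (q s) (Z s)) t}.

Definition rolling (tau : R) (q : R -> configuration) : Prop :=
  [/\ ac_configuration_curve tau q, no_slip tau q & no_twist tau q].

End Rolling.

(* Main.v *)
(** A rolling [q] is an isometry at each time and commutes with covariant
    derivatives, so it carries [v_1] to the first Frenet vector of the other
    curve (no slip) and then, inductively, [D v_j + kappa_(j-1) v_(j-1)] to its
    counterpart; since [q] preserves norms and orientation, it carries Frenet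
    frames to Frenet frames and the curvatures agree.  No slip and no twist hold
    almost everywhere only, but both sides are continuous.

    Conversely, let [q(t)] be the isometry that maps one Frenet frame to the
    other.  The Frenet equations express the derivatives of each frame in the
    frame itself through the curvatures, so when the curvatures agree
    differentiating the coordinates of a field in the frame shows that [q]
    commutes with covariant derivatives. *)

Require Import Defs.
From HB Require Import structures.
From mathcomp Require Import all_boot all_order all_algebra.
From mathcomp Require Import all_classical all_reals all_analysis.
From mathcomp Require Import ring lra zify.
Import Order.TTheory GRing.Theory Num.Theory numFieldNormedType.Exports.
Local Open Scope classical_set_scope.
Local Open Scope ring_scope.
Set Implicit Arguments.
Unset Strict Implicit.
Unset Printing Implicit Defensive.


(** * Derivatives relative to a set of parameters *)

Section DerivIn.
Context {R : realType}.
Implicit Types (A B : set R) (t : R).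

(** A covariant derivative is one tangent vector that satisfies the coordinate formula in every
    chart at once, and 0 when there is none. That such a vector exists rests on the transformation
    law of the Christoffel symbols, which needs the symmetry of the second derivatives of the
    transition maps; hence the long preparation in coordinates.

    Regularity is tight: each Frenet step spends one derivative, so v_(n-1) is only known to be C^1
    and its covariant derivative continuous. The field v_n therefore cannot get its regularity from
    differentiation. It is an algebraic expression in the metric and v_1, ..., v_(n-1), hence C^1 as
    well, and only so can it be differentiated like the others.

    No twist also concerns fields that have no covariant derivative at a given time; there both
    sides have to be shown to take the default value together.

    Tangent spaces are types that depend on the point, so fields along two curves that agree on
    [[0, tau]] have different types. A congruence relation on coordinates carries all invariants
    from one curve to the other. *)

Lemma is_deriv_inP {V : normedModType R} A (f : R -> V) t l :
  is_deriv_in A f t l <->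
  forall e, 0 < e -> exists2 d, 0 < d &
    forall s, A s -> `|s - t| < d -> s != t ->
      `|l - (s - t)^-1 *: (f s - f t)| < e.
Proof.
split=> [/cvgrPdist_lt H e /H|H].
  rewrite near_withinE /= => /nbhs_ballP[d /= d0 dP].
  exists d => // s As std st; apply: dP => //.
  by rewrite /ball/= distrC.
apply/cvgrPdist_lt => e /H[d d0 dP]; rewrite near_withinE.
apply/nbhs_ballP; exists d => //= s; rewrite /ball/= distrC => std st As.
exact: dP.
Qed.

Lemma is_derive_setT {V : normedModType R} (f : R -> V) t l :
  is_derive t 1 f l <-> is_deriv_in setT f t l.
Proof.
have E : is_derive t 1 f l <->
    (fun h => h^-1 *: ((f \o shift t) (h *: (1 : R)) - f t)) @ 0^' --> l.
  split=> [[fd <-]//|fl]; split; first by apply/cvg_ex; exists l.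
  exact/cvg_lim.
rewrite E is_deriv_inP; split=> [/cvgrPdist_lt H e /H /nbhs_ballP[d /= d0 dP]|H].
  exists d => // s _ std st; have := dP (s - t).
  rewrite /ball /= sub0r normrN std subr_eq0 => /(_ erefl st).
  by rewrite [_%:A]mulr1 subrK.
apply/cvgrPdist_lt => e /H[d d0 dP]; apply/nbhs_ballP; exists d => //= h.
rewrite /ball/= sub0r normrN => hd h0.
have := dP (h + t) I; rewrite addrK => /(_ hd) /=; rewrite [_%:A]mulr1; apply.
by rewrite -subr_eq0 addrK.
Qed.

(** Only the germs of the set and of the function at [t] matter. This exchanges the whole interval
    for the part of it that a chart covers. *)
Lemma deriv_in_near {V : normedModType R} A B (f g : R -> V) t l :
  (\forall s \near t, A s -> B s /\ f s = g s) -> f t = g t ->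
  is_deriv_in B f t l -> is_deriv_in A g t l.
Proof.
move=> /nbhs_ballP[d /= d0 dP] fg /is_deriv_inP H.
apply/is_deriv_inP => e /H[c c0 cP]; exists (Num.min c d).
  by rewrite lt_min c0.
move=> s As; rewrite lt_min => /andP[sc sd] st.
have [|Bs fgs] := dP s _ As; first by rewrite /ball/= distrC.
by rewrite -fg -fgs; exact: cP.
Qed.

Lemma deriv_in_eq {V : normedModType R} A (f g : R -> V) t l :
  (forall s, A s -> f s = g s) -> A t ->
  is_deriv_in A f t l -> is_deriv_in A g t l.
Proof.
move=> fg At; apply: deriv_in_near; last exact: fg.
by near=> s => As; split=> //; exact: fg.
Unshelve. all: by end_near. Qed.

(* Extending [f] linearly outside [A] reduces relative derivatives to ordinary ones. *)
Lemma is_deriv_in_ext {V : normedModType R} A (f : R -> V) t l :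
  is_deriv_in A f t l <->
  exists2 g : R -> V, is_derive t 1 g l & g t = f t /\ forall s, A s -> g s = f s.
Proof.
split=> [H|[g /is_derive_setT gl [gt gA]]]; last first.
  apply: deriv_in_near gt gl.
  by near=> s => As; split=> //; exact: gA.
exists (fun s => if `[< A s >] then f s else f t + (s - t) *: l); last first.
  split; last by move=> s As; rewrite asboolT.
  by case: asboolP => // _; rewrite subrr scale0r addr0.
apply/is_derive_setT/is_deriv_inP => e e0.
have ->: (if `[< A t >] then f t else f t + (t - t) *: l) = f t.
  by rewrite subrr scale0r addr0 if_same.
have /is_deriv_inP/(_ _ e0)[d d0 dP] := H; exists d => // s _ std st.
case: asboolP => [As|nAs]; first exact: dP.
rewrite [f t + _]addrC addrK scalerA mulVf ?subr_eq0// scale1r subrr normr0 //.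
Unshelve. all: by end_near. Qed.

Lemma deriv_in_continuous {V : normedModType R} A (f : R -> V) t l :
  is_deriv_in A f t l -> f @ within A (nbhs t) --> f t.
Proof.
move=> /is_deriv_in_ext[g [gd _] [<- gA]].
have /derivable1_diffP /differentiable_continuous gc := gd.
have gw : g @ within A (nbhs t) --> g t by apply: cvg_within_filter; exact: gc.
apply: (cvg_trans _ gw); apply: near_eq_cvg.
by rewrite near_withinE; near=> s => As; exact: gA.
Unshelve. all: by end_near. Qed.

Lemma deriv_in_comp {V W : normedModType R} A (f : R -> V) (F : V -> W) t l :
  differentiable F (f t) -> is_deriv_in A f t l ->
  is_deriv_in A (F \o f) t ('d F (f t) l).
Proof.
move=> Fd /is_deriv_in_ext[g gl [gt gA]]; apply/is_deriv_in_ext.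
exists (F \o g); last by split=> [|s As] /=; rewrite ?gt ?gA.
have gd : differentiable g t by apply/derivable1_diffP; case: gl.
have Fgd : differentiable F (g t) by rewrite gt.
split; first exact/derivable1_diffP/differentiable_comp.
rewrite deriveE; last exact/differentiable_comp.
by rewrite diff_comp //= gt; congr ('d _ _ _); rewrite -deriveE//; case: gl.
Qed.

Lemma deriv_in_cst {V : normedModType R} A (c : V) t : is_deriv_in A (fun=> c) t 0.
Proof. by apply/is_deriv_in_ext; exists (fun=> c) => //; exact: is_derive_cst. Qed.

Lemma deriv_inD {V : normedModType R} A (f g : R -> V) t k l :
  is_deriv_in A f t k -> is_deriv_in A g t l ->
  is_deriv_in A (fun s => f s + g s) t (k + l).
Proof.
move=> /is_deriv_in_ext[f' fk [ft fA]] /is_deriv_in_ext[g' gl [gt gA]].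
apply/is_deriv_in_ext; exists (f' + g'); first exact: is_deriveD.
by split=> [|s As]; rewrite fctE ?ft ?gt ?fA ?gA.
Qed.

Lemma deriv_inM A (f g : R -> R) t k l :
  is_deriv_in A f t k -> is_deriv_in A g t l ->
  is_deriv_in A (fun s => f s * g s) t (k * g t + f t * l).
Proof.
move=> /is_deriv_in_ext[f' fk [ft fA]] /is_deriv_in_ext[g' gl [gt gA]].
apply/is_deriv_in_ext; exists (f' * g').
  apply: is_derive_eq; rewrite ft gt addrC [k * _]mulrC //.
by split=> [|s As]; rewrite fctE ?ft ?gt ?fA ?gA.
Qed.

Lemma deriv_in_mxP {m n} A (f : R -> 'M[R]_(m, n)) t l :
  is_deriv_in A f t l <->
  forall i j, is_deriv_in A (fun s => f s i j) t (l i j).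
Proof.
split=> [fl i j|H].
  have := deriv_in_comp (differentiable_coord (f t) i j) fl.
  rewrite (_ : 'd _ _ _ = l i j)//.
  have fL : linear (fun N : 'M[R]_(m, n) => N i j : R^o) by move=> ? ? ?; rewrite !mxE.
  pose fM := GRing.isLinear.Build _ _ _ _ _ fL.
  pose F : {linear _ -> _} := HB.pack (fun N : 'M[R]_(m, n) => N i j : R^o) fM.
  by rewrite (diff_lin _ (f := F))//; exact: coord_continuous.
apply/cvgrPdist_lt => e e0.
have {}H : \forall s \near within A t^', forall k : 'I_m * 'I_n,
    `|l k.1 k.2 - (s - t)^-1 *: (f s k.1 k.2 - f t k.1 k.2)| < e.
  by apply: filter_forall => k; have /cvgrPdist_lt/(_ _ e0) := H k.1 k.2.
apply: filterS H => s H.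
rewrite [ltLHS]/Num.Def.normr/= mx_normrE; apply/bigmax_ltP; split=> // k _.
by rewrite !mxE; exact: H.
Qed.

Lemma deriv_in_sum {V : normedModType R} A n (f : 'I_n -> R -> V) t l :
  (forall i, is_deriv_in A (f i) t (l i)) ->
  is_deriv_in A (fun s => \sum_i f i s) t (\sum_i l i).
Proof.
elim: n f l => [|n IHn] f l H.
  rewrite big_ord0 (_ : (fun _ => _) = fun=> 0); first exact: deriv_in_cst.
  by apply/funext => s; rewrite big_ord0.
rewrite big_ord_recl (_ : (fun _ => _) =
    fun s => f ord0 s + \sum_(i < n) f (lift ord0 i) s).
  by apply: deriv_inD => //; exact: IHn.
by apply/funext => s; rewrite big_ord_recl.
Qed.

Lemma deriv_in_unique {V : normedModType R} A (f : R -> V) t k l :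
  ProperFilter (within A t^') ->
  is_deriv_in A f t k -> is_deriv_in A f t l -> k = l.
Proof. by move=> F; apply: cvg_unique; exact: norm_hausdorff. Qed.

Lemma deriv_inZ {m n} A (c : R -> R) (f : R -> 'M[R]_(m, n)) t k l :
  is_deriv_in A c t k -> is_deriv_in A f t l ->
  is_deriv_in A (fun s => c s *: f s) t (k *: f t + c t *: l).
Proof.
move=> ck /deriv_in_mxP fl; apply/deriv_in_mxP => i j; rewrite !mxE.
rewrite (_ : (fun _ => _) = fun s => c s * f s i j); first exact: deriv_inM.
by apply/funext => s; rewrite !mxE.
Qed.

Lemma deriv_in_mulmx {m n p} A (f : R -> 'M[R]_(m, n)) (g : R -> 'M[R]_(n, p)) t k l :
  is_deriv_in A f t k -> is_deriv_in A g t l ->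
  is_deriv_in A (fun s => f s *m g s) t (k *m g t + f t *m l).
Proof.
move=> /deriv_in_mxP fk /deriv_in_mxP gl; apply/deriv_in_mxP => i j.
rewrite !mxE -big_split/=.
rewrite (_ : (fun _ => _) = fun s => \sum_a f s i a * g s a j).
  by apply: deriv_in_sum => a; exact: deriv_inM.
by apply/funext => s; rewrite !mxE.
Qed.

Lemma deriv_in_trmx {m n} A (f : R -> 'M[R]_(m, n)) t l :
  is_deriv_in A f t l -> is_deriv_in A (fun s => (f s)^T) t l^T.
Proof.
move=> /deriv_in_mxP H; apply/deriv_in_mxP => i j; rewrite mxE.
rewrite (_ : (fun _ => _) = fun s => f s j i); first exact: H.
by apply/funext => s; rewrite mxE.
Qed.

Lemma deriv_inV A (f : R -> R) t l : f t != 0 ->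
  is_deriv_in A f t l ->
  is_deriv_in A (fun s => (f s)^-1) t (- l * (f t)^-1 * (f t)^-1).
Proof.
move=> ft0 fl; have := deriv_in_comp (differentiable_Rinv ft0) fl.
suff -> : 'd (@GRing.inv R) (f t) l = - l * (f t)^-1 * (f t)^-1 by [].
rewrite diff_Rinv//= -[_ *: _]/(_ * _); field.
exact: ft0.
Qed.

Lemma deriv_in_sqrt A (f : R -> R) t l : 0 < f t ->
  is_deriv_in A f t l ->
  is_deriv_in A (fun s => Num.sqrt (f s)) t (l * (2 * Num.sqrt (f t))^-1).
Proof.
move=> ft0 fl; have sd := is_derive1_sqrt ft0.
have sdiff : differentiable (@Num.sqrt R) (f t) by apply/derivable1_diffP; case: sd.
have := deriv_in_comp sdiff fl.
rewrite (diff1E sdiff) derive1E (derive_val (is_derive := sd)).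
by rewrite -[_ *: _]/(_ * _).
Qed.

End DerivIn.

(** * Functions of class C^k on a set of parameters *)

Section CkIn.
Context {R : realType}.
Implicit Types (A B : set R) (t : R).

Lemma Ck_in_eq {V : normedModType R} k A (f g : R -> V) :
  (forall t, A t -> f t = g t) -> Ck_in k A f -> Ck_in k A g.
Proof.
case: k => [|k] fg /=.
  move=> /subspace_continuousP fc; apply/subspace_continuousP => t At.
  change (g @ within A (nbhs t) --> g t).
  rewrite -fg//; apply: (cvg_trans _ (fc t At)); apply: near_eq_cvg.
  by rewrite near_withinE; near=> s => As; exact: fg.
move=> [f' ff' f'k]; exists f' => // t At.
exact: (deriv_in_eq fg At (ff' t At)).
Unshelve. all: by end_near. Qed.

Lemma Ck_in_continuous {V : normedModType R} k A (f : R -> V) :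
  Ck_in k A f -> {within A, continuous f}.
Proof.
case: k => [//|k] [f' ff' _]; apply/subspace_continuousP => t At.
exact: deriv_in_continuous (ff' t At).
Qed.

Lemma Ck_inW {V : normedModType R} k A (f : R -> V) : Ck_in k.+1 A f -> Ck_in k A f.
Proof.
elim: k f => [|k IHk] f H; first exact: Ck_in_continuous H.
by case: H => f' ff' f'k; exists f' => //; exact: IHk.
Qed.

Lemma Ck_in_le {V : normedModType R} m k A (f : R -> V) : (m <= k)%N ->
  Ck_in k A f -> Ck_in m A f.
Proof.
elim: k => [|k IHk]; first by rewrite leqn0 => /eqP->.
by rewrite leq_eqVlt => /predU1P[->//|mk /Ck_inW]; exact: IHk.
Qed.

Lemma Ck_in_sub {V : normedModType R} k A B (f : R -> V) : B `<=` A ->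
  Ck_in k A f -> Ck_in k B f.
Proof.
move=> BA; elim: k f => [|k IHk] f; first exact: continuous_subspaceW.
move=> [f' ff' /IHk f'k]; exists f' => // t Bt.
apply: deriv_in_near (ff' t (BA _ Bt)) => //.
by near=> s => Bs; split => //; exact: BA.
Unshelve. all: by end_near. Qed.

Lemma Ck_in_cst {V : normedModType R} k A (c : V) : Ck_in k A (fun=> c).
Proof.
elim: k c => [|k IHk] c /=; first by move=> t; exact: cvg_cst.
by exists (fun=> 0) => // t _; exact: deriv_in_cst.
Qed.

Lemma Ck_inD {V : normedModType R} k A (f g : R -> V) :
  Ck_in k A f -> Ck_in k A g -> Ck_in k A (fun t => f t + g t).
Proof.
elim: k f g => [|k IHk] f g /=.
  by move=> fc gc t; apply: cvgD; [exact: fc|exact: gc].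
move=> [f' ff' f'k] [g' gg' g'k]; exists (fun t => f' t + g' t); last exact: IHk.
by move=> t At; apply: deriv_inD; [exact: ff'|exact: gg'].
Qed.

Lemma Ck_inM k A (f g : R -> R) :
  Ck_in k A f -> Ck_in k A g -> Ck_in k A (fun t => f t * g t).
Proof.
elim: k f g => [|k IHk] f g.
  by move=> /= fc gc t; apply: cvgM; [exact: fc|exact: gc].
move=> /[dup] /Ck_inW fk [f' ff' f'k] /[dup] /Ck_inW gk [g' gg' g'k].
exists (fun t => f' t * g t + f t * g' t).
  by move=> t At; apply: deriv_inM; [exact: ff'|exact: gg'].
by apply: Ck_inD; exact: IHk.
Qed.

Lemma Ck_inN k A (f : R -> R) : Ck_in k A f -> Ck_in k A (fun t => - f t).
Proof.
move=> fk; apply: (@Ck_in_eq _ _ _ (fun t => -1 * f t)) => [t _|].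
  by rewrite mulN1r.
by apply: Ck_inM => //; exact: Ck_in_cst.
Qed.

Lemma Ck_in_sum {V : normedModType R} k A n (f : 'I_n -> R -> V) :
  (forall i, Ck_in k A (f i)) -> Ck_in k A (fun s => \sum_i f i s).
Proof.
elim: n f => [|n IHn] f H.
  apply: (@Ck_in_eq _ _ _ (fun=> 0)) => [t _|]; first by rewrite big_ord0.
  exact: Ck_in_cst.
apply: (@Ck_in_eq _ _ _ (fun s => f ord0 s + \sum_(i < n) f (lift ord0 i) s)).
  by move=> t _; rewrite big_ord_recl.
by apply: Ck_inD => //; exact: IHn.
Qed.

Lemma Ck_in_mxP {m n} k A (f : R -> 'M[R]_(m, n)) :
  Ck_in k A f <-> forall i j, Ck_in k A (fun s => f s i j).
Proof.
elim: k f => [|k IHk] f.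
  split=> [fc i j|H].
    move=> t; apply: (@cvg_comp _ _ _ f (fun N : 'M[R]_(m, n) => N i j)); first exact: fc.
    exact: coord_continuous.
  apply/subspace_continuousP => t At; apply/cvgrPdist_lt => e e0.
  have {}H : \forall s \near within A (nbhs t), forall k : 'I_m * 'I_n,
      `|f t k.1 k.2 - f s k.1 k.2| < e.
    apply: filter_forall => k.
    by have /subspace_continuousP/(_ _ At)/cvgrPdist_lt/(_ _ e0) := H k.1 k.2.
  apply: filterS H => s H.
  rewrite [ltLHS]/Num.Def.normr/= mx_normrE; apply/bigmax_ltP; split=> // k _.
  by rewrite !mxE; exact: H.
split=> [[f' ff' /IHk f'k] i j|H].
  exists (fun s => f' s i j) => [t At|//].
  by have /deriv_in_mxP := ff' t At; exact.
(* Each entry comes only with the existence of a derivative; these are chosen and assembled into a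
   matrix. *)
pose f' s : 'M[R]_(m, n) := \matrix_(i, j) s2val (cid2 (H i j)) s.
exists f'.
  move=> t At; apply/deriv_in_mxP => i j; rewrite mxE.
  by case: (cid2 (H i j)) => /= g gd _; exact: gd.
apply/IHk => i j; apply: (@Ck_in_eq _ _ _ (s2val (cid2 (H i j)))) => [t _|].
  by rewrite mxE.
by case: (cid2 (H i j)).
Qed.

Lemma Ck_inZ {m n} k A (c : R -> R) (f : R -> 'M[R]_(m, n)) :
  Ck_in k A c -> Ck_in k A f -> Ck_in k A (fun s => c s *: f s).
Proof.
move=> ck /Ck_in_mxP fl; apply/Ck_in_mxP => i j.
apply: (@Ck_in_eq _ _ _ (fun s => c s * f s i j)); last exact: Ck_inM.
by move=> t _; rewrite mxE.
Qed.

Lemma Ck_in_mulmx {m n p} k A (f : R -> 'M[R]_(m, n)) (g : R -> 'M[R]_(n, p)) :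
  Ck_in k A f -> Ck_in k A g -> Ck_in k A (fun s => f s *m g s).
Proof.
move=> /Ck_in_mxP fk /Ck_in_mxP gk; apply/Ck_in_mxP => i j.
apply: (@Ck_in_eq _ _ _ (fun s => \sum_a f s i a * g s a j)) => [t _|].
  by rewrite mxE.
by apply: Ck_in_sum => a; exact: Ck_inM.
Qed.

Lemma Ck_in_trmx {m n} k A (f : R -> 'M[R]_(m, n)) :
  Ck_in k A f -> Ck_in k A (fun s => (f s)^T).
Proof.
move=> /Ck_in_mxP fk; apply/Ck_in_mxP => i j.
by apply: Ck_in_eq (fk j i) => t _; rewrite mxE.
Qed.

Lemma Ck_in_det n k A (f : R -> 'M[R]_n) :
  Ck_in k A f -> Ck_in k A (fun s => \det (f s)).
Proof.
elim: n f => [|n IHn] f /Ck_in_mxP fk.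
  by apply: Ck_in_eq (Ck_in_cst k A (1 : R)) => t _; rewrite det_mx00.
apply: (@Ck_in_eq R _ _ (fun t => \sum_j f t ord0 j * cofactor (f t) ord0 j)).
  by move=> t _; rewrite -expand_det_row.
apply: Ck_in_sum => j; apply: Ck_inM; first exact: fk.
apply: Ck_inM; first exact: Ck_in_cst.
apply: IHn; apply/Ck_in_mxP => a b.
by apply: Ck_in_eq (fk (lift ord0 a) (lift j b)) => t _; rewrite !mxE.
Qed.

Lemma Ck_in_cofactor n k A (f : R -> 'M[R]_n) i j :
  Ck_in k A f -> Ck_in k A (fun s => cofactor (f s) i j).
Proof.
move=> /Ck_in_mxP fk; apply: Ck_inM; first exact: Ck_in_cst.
apply: Ck_in_det; apply/Ck_in_mxP => a b.
by apply: Ck_in_eq (fk (lift i a) (lift j b)) => t _; rewrite !mxE.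
Qed.

(** The derivative is a product of [f'] and of inverses of [f], and [f] is also C^k, so the
    induction hypothesis applies to the same [f]. *)
Lemma Ck_inV k A (f : R -> R) : (forall t, A t -> f t != 0) ->
  Ck_in k A f -> Ck_in k A (fun t => (f t)^-1).
Proof.
move=> f0; elim: k f f0 => [|k IHk] f f0.
  move=> /subspace_continuousP fc; apply/subspace_continuousP => t At.
  by apply: cvgV; [exact: f0|exact: fc].
move=> /[dup] /Ck_inW fk [f' ff' f'k].
exists (fun t => - f' t * (f t)^-1 * (f t)^-1).
  by move=> t At; apply: deriv_inV; [exact: f0|exact: ff'].
by apply: Ck_inM; [apply: Ck_inM; [exact: Ck_inN|exact: IHk]|exact: IHk].
Qed.

Lemma Ck_in_sqrt k A (f : R -> R) : (forall t, A t -> 0 < f t) ->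
  Ck_in k A f -> Ck_in k A (fun t => Num.sqrt (f t)).
Proof.
move=> f0; elim: k f f0 => [|k IHk] f f0.
  move=> /subspace_continuousP fc; apply/subspace_continuousP => t At.
  apply: (@cvg_comp _ _ _ f Num.sqrt); first exact: fc.
  exact: sqrt_continuous.
move=> /[dup] /Ck_inW fk [f' ff' f'k].
exists (fun t => f' t * (2 * Num.sqrt (f t))^-1).
  by move=> t At; apply: deriv_in_sqrt; [exact: f0|exact: ff'].
apply: Ck_inM => //; apply: Ck_inV => [t At|].
  by rewrite mulf_neq0// gt_eqF// sqrtr_gt0 f0.
by apply: Ck_inM; [exact: Ck_in_cst|exact: IHk].
Qed.

Lemma Ck_in_invmx n k A (f : R -> 'M[R]_n) : (forall t, A t -> f t \in unitmx) ->
  Ck_in k A f -> Ck_in k A (fun s => invmx (f s)).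
Proof.
move=> fu fk; apply: (@Ck_in_eq _ _ _ (fun t => (\det (f t))^-1 *: \adj (f t))).
  by move=> t At; rewrite /invmx fu.
apply: Ck_inZ; first apply: Ck_inV.
- by move=> t At; have := fu t At; rewrite unitmxE unitfE.
- exact: Ck_in_det.
apply/Ck_in_mxP => i j; apply: Ck_in_eq (Ck_in_cofactor j i fk) => t _.
by rewrite mxE.
Qed.

Lemma deriv_in_comp_rV {n m p} A (f : R -> 'rV[R]_n)
    (F : 'rV[R]_n -> 'M[R]_(m, p)) t l :
  differentiable F (f t) -> is_deriv_in A f t l ->
  is_deriv_in A (F \o f) t (\sum_a l 0 a *: 'D_(delta_mx 0 a) F (f t)).
Proof.
move=> Fd fl; have := deriv_in_comp Fd fl.
suff -> : 'd F (f t) l = \sum_a l 0 a *: 'D_(delta_mx 0 a) F (f t) by [].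
rewrite {1}[l]row_sum_delta linear_sum; apply: eq_bigr => a _.
by rewrite linearZ deriveE.
Qed.

(** The chain rule gives a combination of the partial derivatives of [F] along [f]. The induction
    hypothesis covers them because [Ck_on] asks for the regularity of every directional
    derivative. *)
Lemma Ck_in_comp {n m p} k A (U : set 'rV[R]_n) (f : R -> 'rV[R]_n)
    (F : 'rV[R]_n -> 'M[R]_(m, p)) : (forall t, A t -> U (f t)) ->
  Ck_on k U F -> Ck_in k A f -> Ck_in k A (F \o f).
Proof.
move=> AU; elim: k F => [|k IHk] F.
  move=> Fc /subspace_continuousP fc; apply/subspace_continuousP => t At.
  by apply: cvg_comp; [exact: fc|exact/Fc/AU].
move=> [Fd DF] /[dup] /Ck_inW fk [f' ff' /Ck_in_mxP f'k].
exists (fun t => \sum_a f' t 0 a *: 'D_(delta_mx 0 a) F (f t)).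
  by move=> t At; apply: deriv_in_comp_rV; [exact/Fd/AU|exact: ff'].
apply: Ck_in_sum => a; apply: Ck_inZ; first exact: f'k.
by apply: (IHk ('D_(delta_mx 0 a) F)) => //; exact: DF.
Qed.

End CkIn.

Lemma is_derive_line {R : realType} {V W : normedModType R} (F : V -> W) c v t :
  differentiable F (c + t *: v) ->
  is_derive t 1 (fun s => F (c + s *: v)) ('D_v F (c + t *: v)).
Proof.
move=> Fd; apply/is_derive_setT; rewrite deriveE//.
apply: (@deriv_in_comp _ _ _ _ (fun s => c + s *: v) F) => //.
rewrite -[v in X in is_deriv_in _ _ _ X]add0r; apply: deriv_inD.
  exact: deriv_in_cst.
apply/is_derive_setT; rewrite -[v in X in is_derive _ _ _ X]scale1r.
split; last by rewrite deriveE ?diff_val.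
exact/derivable1_diffP.
Qed.

Lemma cvg_line {R : realType} {V : normedModType R} (u v : V) :
  (fun s : R => u + s *: v) @ 0 --> u.
Proof.
rewrite -[X in _ --> X]addr0 -(scale0r v); apply: cvgD; first exact: cvg_cst.
by apply: cvgZr_tmp; exact: cvg_id.
Qed.

(** * Symmetry of second derivatives *)

Section Schwarz.
Context {R : realType} {V : normedModType R}.
Implicit Types (f g : V -> R) (u v w : V).

Lemma differentiable_mx {m n} (F : V -> 'M[R]_(m, n)) u i j :
  differentiable F u -> differentiable (fun y => F y i j) u.
Proof.
move=> Fd; apply: (@differentiable_comp _ _ _ _ F (fun N : 'M[R]_(m, n) => N i j)) => //.
exact: differentiable_coord.
Qed.

Lemma derive_mxE {m n} (F : V -> 'M[R]_(m, n)) u v i j :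
  differentiable F u -> 'D_v (fun y => F y i j) u = 'D_v F u i j.
Proof. by move=> Fd; rewrite derive_mx ?mxE//; exact: diff_derivable. Qed.

(** The mean value theorem twice: along [v] for the increment of [f] in the direction [w], then
    along [w] for [g]. Up to the order of its terms the left side is symmetric in [v] and [w]. *)
Lemma second_difference f g u v w (e h : R) :
  (forall p, `|p - u| < e ->
    [/\ differentiable f p, 'D_v f p = g p & differentiable g p]) ->
  0 < h -> h * (`|v| + `|w|) < e ->
  exists2 p, `|p - u| < e &
    f (u + h *: v + h *: w) - f (u + h *: v) - (f (u + h *: w) - f u) =
    'D_w g p * h * h.
Proof.
move=> fd h0 he.
have inb r s : 0 <= r <= h -> 0 <= s <= h -> `|u + r *: v + s *: w - u| < e.
  move=> /andP[r0 rh] /andP[s0 sh]; apply: le_lt_trans he.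
  rewrite -[u + _ + _]addrA [u + _]addrC addrK mulrDr (le_trans (ler_normD _ _))// !normrZ.
  by rewrite !ger0_norm// lerD// ler_wpM2r.
have h00 : 0 <= (0 : R) <= h by rewrite lexx ltW.
have hh : 0 <= h <= h by rewrite lexx ltW.
pose G r : R := f (u + h *: w + r *: v) - f (u + r *: v).
have Gd r : 0 <= r <= h -> is_derive r 1 G
    (g (u + h *: w + r *: v) - g (u + r *: v)).
  move=> rh; have [|d1 <- _] := fd (u + h *: w + r *: v).
    by rewrite [u + h *: w + _]addrAC; exact: inb.
  have [|d2 <- _] := fd (u + r *: v).
    by have := inb r 0 rh h00; rewrite scale0r addr0.
  by apply: is_deriveB; exact: is_derive_line.
have [r /andP[r0 rh] Gr] : exists2 r, 0 <= r <= h & G h - G 0 =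
    (g (u + h *: w + r *: v) - g (u + r *: v)) * h.
  have [||r rh Gr] := @MVT_segment _ G
    (fun r => g (u + h *: w + r *: v) - g (u + r *: v)) 0 h (ltW h0).
  - by move=> r; rewrite in_itv/= => /andP[r0 rh]; apply: Gd; rewrite !ltW.
  - apply: derivable_within_continuous => r; rewrite in_itv/= => rh.
    by have [] := Gd r rh.
  by exists r; [move: rh; rewrite in_itv|rewrite Gr subr0].
pose H s : R := g (u + r *: v + s *: w).
have Hd s : 0 <= s <= h -> is_derive s 1 H ('D_w g (u + r *: v + s *: w)).
  move=> sh; apply: is_derive_line.
  by have [|//] := fd (u + r *: v + s *: w); apply: inb; rewrite ?r0.
have [s sh Hs] : exists2 s, 0 <= s <= h & H h - H 0 =
    'D_w g (u + r *: v + s *: w) * h.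
  have [||s sh Hs] := @MVT_segment _ H (fun s => 'D_w g (u + r *: v + s *: w)) 0 h (ltW h0).
  - by move=> s; rewrite in_itv/= => /andP[s0 sh]; apply: Hd; rewrite !ltW.
  - apply: derivable_within_continuous => s; rewrite in_itv/= => sh.
    by have [] := Hd s sh.
  by exists s; [move: sh; rewrite in_itv|rewrite Hs subr0].
exists (u + r *: v + s *: w); first by apply: inb => //; rewrite r0.
rewrite -Hs /H scale0r addr0 [u + r *: v + _]addrAC -Gr /G !scale0r !addr0.
by rewrite [u + h *: w + _]addrAC.
Qed.

(** The second difference over the parallelogram spanned by [h *: v] and [h *: w] is [h * h] times
    either mixed derivative, each taken at some point near [u]. So the two agree at nearby points,
    and by continuity at [u]. Entries are treated one by one, as the mean value theorem is about
    real functions. *)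
Lemma derive_swap {m n} (U : set V) (F : V -> 'M[R]_(m, n)) u v w : open U ->
  Ck_on 2 U F -> U u -> 'D_v ('D_w F) u = 'D_w ('D_v F) u.
Proof.
move=> Uo [Fd DF] Uu; apply/matrixP => i j; apply/eqP.
rewrite -subr_eq0 -normr_le0.
apply/ler_addgt0Pl => e e0; rewrite addr0.
have close (a b p q : R) : p = q -> `|a - q| < e / 2 -> `|b - p| < e / 2 -> `|a - b| <= e.
  move=> -> aq bq; rewrite -(subrKA q) (le_trans (ler_normD _ _))//.
  by rewrite [e in leRHS]splitr lerD// ltW// distrC.
have e20 : 0 < e / 2 by rewrite divr_gt0.
have cont x y : \forall p \near u,
    `|'D_x ('D_y F) u i j - 'D_x ('D_y F) p i j| < e / 2.
  have c : {for u, continuous ('D_x ('D_y F))} by have [_] := DF y; apply.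
  have : (fun p => 'D_x ('D_y F) p i j) @ u --> 'D_x ('D_y F) u i j.
    apply: (@cvg_comp _ _ _ ('D_x ('D_y F)) (fun N : 'M[R]_(m, n) => N i j)).
      exact: c.
    exact: coord_continuous.
  by move/cvgrPdist_lt => /(_ _ e20).
have H0 : \forall p \near u, U p by exact: open_nbhs_nbhs.
have /nbhs_ballP[d /= d0 dP] : \forall p \near u, [/\ U p,
    `|'D_v ('D_w F) u i j - 'D_v ('D_w F) p i j| < e / 2 &
    `|'D_w ('D_v F) u i j - 'D_w ('D_v F) p i j| < e / 2].
  by apply: filterS3 H0 (cont v w) (cont w v).
have {}dP p : `|p - u| < d -> [/\ U p,
    `|'D_v ('D_w F) u i j - 'D_v ('D_w F) p i j| < e / 2 &
    `|'D_w ('D_v F) u i j - 'D_w ('D_v F) p i j| < e / 2].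
  by move=> pu; apply: dP; rewrite -ball_normE/= distrC.
have s1 : 0 < `|v| + `|w| + 1 by rewrite ltr_wpDl ?addr_ge0.
(* This keeps the parallelogram within distance [d] of [u]; the summand 1 covers the case where both
   directions vanish. *)
pose h := d / (`|v| + `|w| + 1).
have h0 : 0 < h by rewrite divr_gt0.
have hd : h * (`|v| + `|w|) < d.
  by rewrite /h -mulrA -[ltRHS]mulr1 ltr_pM2l// mulrC ltr_pdivrMr// mul1r ltrDl.
have fd x p : U p -> [/\ differentiable (fun y => F y i j) p,
    'D_x (fun y => F y i j) p = 'D_x F p i j &
    differentiable (fun y => 'D_x F y i j) p].
  move=> Up; rewrite derive_mxE; last exact: Fd.
  by split=> //; apply: differentiable_mx; [exact: Fd|have [+ _] := DF x; apply].
have [|p pd pE] := @second_difference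
  (fun y => F y i j) (fun y => 'D_v F y i j) u v w d h _ h0 hd.
  by move=> p /dP[Up _ _]; exact: (fd v p Up).
have [||q qd qE] := @second_difference
  (fun y => F y i j) (fun y => 'D_w F y i j) u w v d h _ h0.
- by move=> q /dP[Uq _ _]; exact: (fd w q Uq).
- by rewrite [`|w| + _]addrC.
have [Up _ Hp] := dP p pd; have [Uq Hq _] := dP q qd.
have : 'D_w ('D_v F) p i j * h * h = 'D_v ('D_w F) q i j * h * h.
  have swap (x y z c : R) : x - y - (z - c) = x - z - (y - c) by ring.
  have Ev := @derive_mxE _ _ ('D_v F) p w i j ((DF v).1 p Up).
  have Ew := @derive_mxE _ _ ('D_w F) q v i j ((DF w).1 q Uq).
  have Ev' := congr1 (fun a => a * h * h) Ev.
  have Ew' := congr1 (fun a => a * h * h) Ew.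
  apply: (eq_trans (esym Ev')); apply: (eq_trans (esym pE)).
  apply: (eq_trans _ Ew'); apply: (eq_trans _ qE).
  by rewrite [u + h *: v + _]addrAC; exact: swap.
move=> /mulIf-/(_ (lt0r_neq0 h0))/mulIf-/(_ (lt0r_neq0 h0)) pq.
exact: (close _ _ _ _ pq Hq Hp).
Qed.

End Schwarz.

(** * Lipschitz bounds, absolute continuity and null sets *)

Section Lipschitz.
Context {R : realType}.

Lemma deriv_in_interior {V : normedModType R} (f : R -> V) a b t l :
  a < t < b -> is_deriv_in `[a, b] f t l -> is_derive t 1 f l.
Proof.
move=> /andP[ta tb] fl; apply/is_derive_setT; apply: deriv_in_near fl => //.
near=> s => _; split=> //=; rewrite in_itv/=; apply/andP; split; apply/ltW.
  by near: s; exact: lt_nbhsr.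
by near: s; exact: lt_nbhsl.
Unshelve. all: by end_near. Qed.

Lemma C1_lipschitz (f : R -> R) a b : Ck_in 1 `[a, b] f ->
  exists2 K, 0 <= K & forall s t, a <= s -> s <= t -> t <= b ->
    `|f t - f s| <= K * (t - s).
Proof.
have [ab|ba] := leP a b; last first.
  move=> _; exists 0 => // s t as_ st tb.
  by have := le_lt_trans (le_trans as_ (le_trans st tb)) ba; rewrite ltxx.
move=> /[dup] /Ck_in_continuous /subspace_continuousP fc [f' ff' f'c].
have f'n : {within `[a, b], continuous (fun t => `|f' t|)}.
  by move=> t; apply: cvg_norm; exact: f'c.
have [c cab cP] := EVT_max ab f'n; exists `|f' c| => // s t as_ st tb.
have sub : `[s, t] `<=` `[a, b].
  by move=> r/=; rewrite !in_itv/= => /andP[sr rt]; rewrite (le_trans as_)// (le_trans rt).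
have [||r rst ->] := @MVT_segment _ f f' s t st; last first.
- rewrite normrM [`|t - s|]ger0_norm ?subr_ge0// ler_wpM2r ?subr_ge0//.
  by apply: cP; exact: sub.
- by apply: continuous_subspaceW sub _; apply/subspace_continuousP.
- move=> r; rewrite in_itv/= => /andP[sr rt].
  apply: (@deriv_in_interior _ _ a b).
    by rewrite (le_lt_trans as_)// (lt_le_trans rt).
  by apply: ff'; apply: sub; rewrite /= in_itv/= !ltW.
Qed.

Lemma C1_abs_continuous {m n} (f : R -> 'M[R]_(m, n)) A a b :
  (forall t, a <= t <= b -> A t) -> Ck_in 1 A f -> abs_continuous a b f.
Proof.
move=> sub fA.
have /Ck_in_mxP fc : Ck_in 1 `[a, b] f.
  by apply: Ck_in_sub fA => t /=; rewrite in_itv; exact: sub.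
have [K K0 KP] : exists2 K, 0 <= K & forall i j s t, a <= s -> s <= t -> t <= b ->
    `|f t i j - f s i j| <= K * (t - s).
  have /choice[g gP] : forall k : 'I_m * 'I_n, exists K, 0 <= K /\
      forall s t, a <= s -> s <= t -> t <= b ->
      `|f t k.1 k.2 - f s k.1 k.2| <= K * (t - s).
    by move=> k; have [K K0 KP] := C1_lipschitz (fc k.1 k.2); exists K.
  (* The sum dominates the constant of every entry, as the maximum norm requires. *)
  exists (\sum_k g k); first by apply: sumr_ge0 => k _; exact: (gP k).1.
  move=> i j s t as_ st tb; apply: le_trans ((gP (i, j)).2 s t as_ st tb) _.
  rewrite ler_wpM2r ?subr_ge0// (bigD1 (i, j))//= lerDl.
  by apply: sumr_ge0 => k _; exact: (gP k).1.
have {}KP s t : a <= s -> s <= t -> t <= b -> `|f t - f s| <= K * (t - s).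
  move=> as_ st tb; rewrite [leLHS]/Num.Def.normr/= mx_normrE.
  apply/bigmax_leP; split=> [|k _]; first by rewrite mulr_ge0// subr_ge0.
  by rewrite !mxE KP.
(* [K + 1] instead of [K], which may be 0. *)
move=> e e0; exists (e / (K + 1)); first by rewrite divr_gt0// ltr_wpDl.
move=> p l r lr _ sd; apply: le_lt_trans (_ : (K + 1) * \sum_(k < p) (r k - l k) < _).
  rewrite mulr_sumr; apply: ler_sum => k _; have [al lrk rb] := lr k.
  by rewrite (le_trans (KP _ _ al lrk rb))// ler_wpM2r ?subr_ge0// lerDl.
by move: sd; rewrite ltr_pdivlMr ?ltr_wpDl// mulrC.
Qed.

Lemma abs_continuous_continuous {V : normedModType R} (f : R -> V) a b :
  abs_continuous a b f -> {within `[a, b], continuous f}.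
Proof.
move=> fac; apply/subspace_continuousP => t /=; rewrite in_itv/= => /andP[ta tb].
apply/cvgrPdist_lt => e /fac[d d0 dP]; rewrite near_withinE.
apply/nbhs_ballP; exists d => //= s; rewrite /ball/= in_itv/= => std /andP[sa sb].
(* A single interval, with [s] and [t] put in order. *)
have := dP 1%N (fun=> Num.min s t) (fun=> Num.max s t).
rewrite !big_ord1 => dP'.
have {dP'}: `|f (Num.max s t) - f (Num.min s t)| < e.
  apply: dP'.
  - by move=> _; rewrite le_min sa ta ge_max sb tb/= ge_min !le_max lexx.
  - by move=> i j; rewrite (ord1 i) (ord1 j) eqxx.
  - have [st|ts] := leP s t; first exact: le_lt_trans (ler_norm _) std.
    by apply: le_lt_trans (ler_norm _) _; rewrite distrC.
by rewrite /from_subspace; have [st|ts] := leP s t => //; rewrite distrC.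
Qed.

(** By continuity a nonzero value persists on a relative neighbourhood, and this contains an open
    interval of positive length, which no null set does. *)
Lemma ae_eq0_within {V : normedModType R} (f : R -> V) a b : a < b ->
  {within `[a, b], continuous f} ->
  {ae lebesgue_measure, forall t : R, t \in `[a, b] -> f t = 0} ->
  forall t, t \in `[a, b] -> f t = 0.
Proof.
move=> ab /subspace_continuousP fc [N [mN N0 NP]] t tab.
apply/eqP; apply/negPn/negP => ft0.
have [d d0 dP] : exists2 d, 0 < d & forall s, s \in `[a, b] -> `|s - t| < d -> f s != 0.
  have nft : 0 < `|f t| by rewrite normr_gt0.
  have /cvgrPdist_lt/(_ _ nft) := fc t tab.
  rewrite near_withinE => /nbhs_ballP[d /= d0 dP]; exists d => // s sab std.
  apply/negP => /eqP fs0; have := dP s; rewrite /ball/= distrC => /(_ std sab).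
  by rewrite /from_subspace fs0 subr0 ltxx.
(* Cut down to [[a, b]] the neighbourhood stays nondegenerate even at an end point, because
   [a < b]. *)
pose c := Num.max a (t - d); pose c' := Num.min b (t + d).
move: (tab); rewrite in_itv/= => /andP[at_ tb].
have cc' : c < c'.
  by rewrite /c /c' lt_min !gt_max ab !(le_lt_trans at_) ?ltrDl//
    ?(lt_le_trans _ tb) ?gtrDl ?oppr_lt0//=; lra.
have sub : `]c, c'[ `<=` N.
  move=> s /=; rewrite in_itv/= /c /c' gt_max lt_min => /andP[/andP[sa sd] /andP[sb sd']].
  apply: NP => /= H; have sab : s \in `[a, b] by rewrite in_itv/= !ltW.
  suff /eqP : f s != 0 by apply; exact: H.
  by apply: dP => //; rewrite ltr_norml; apply/andP; split; lra.
have : (lebesgue_measure `]c, c'[%classic <= lebesgue_measure N)%E.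
  by apply: le_measure; rewrite ?inE.
by rewrite N0 lebesgue_measure_itv/= lte_fin cc' EFinN -EFinD lee_fin subr_le0 leNgt cc'.
Qed.

End Lipschitz.

Lemma deriv_in_line {R : realType} {V W : normedModType R} (F : V -> W) u v :
  differentiable F u -> is_deriv_in setT (fun s => F (u + s *: v)) 0 ('D_v F u).
Proof.
move=> Fd; have E : u + 0 *: v = u by rewrite scale0r addr0.
have Fd0 : differentiable F (u + 0 *: v) by rewrite E.
by have := is_derive_line Fd0; rewrite E => /is_derive_setT.
Qed.

Lemma deriv_setT_unique {R : realType} {V : normedModType R} (f : R -> V) t k l :
  is_deriv_in setT f t k -> is_deriv_in setT f t l -> k = l.
Proof.
by move=> /is_derive_setT[_ <-] /is_derive_setT[_ <-].
Qed.

Lemma derive_expand {R : realType} {n m p} (F : 'rV[R]_n -> 'M[R]_(m, p)) u v :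
  differentiable F u -> 'D_v F u = \sum_a v 0 a *: 'D_(delta_mx 0 a) F u.
Proof.
move=> Fd; rewrite deriveE// {1}[v]row_sum_delta linear_sum; apply: eq_bigr => a _.
by rewrite linearZ deriveE.
Qed.

Lemma derive_chain {R : realType} {U V W : normedModType R} (F : U -> V)
    (G : V -> W) u v : differentiable F u -> differentiable G (F u) ->
  'D_v (G \o F) u = 'D_('D_v F u) G (F u).
Proof.
move=> Fd Gd; rewrite deriveE; last exact: differentiable_comp.
by rewrite diff_comp//= (deriveE _ Gd) (deriveE _ Fd).
Qed.

(** Locked, like [tjac], so that the composite of chart maps is not unfolded in passing. *)
HB.lock Definition transition {R : realType} {n} {M : oriented_riemannian R n}
    (i j : chart M) : 'rV[R]_n -> 'rV[R]_n := chart_map j \o chart_inv i.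

HB.lock Definition tjac {R : realType} {n} {M : oriented_riemannian R n}
    (i j : chart M) (x : M) : 'M[R]_n :=
  jacobian (chart_map j \o chart_inv i) (chart_map i x).

(** * Changes of charts *)

Section Transitions.
Context {R : realType} {n : nat} {M : oriented_riemannian R n}.
Implicit Types (x : M) (i j k : chart M).

Definition overlap i j : set 'rV[R]_n :=
  chart_map i @` (chart_dom i `&` chart_dom j).

Lemma overlapP i j x : chart_dom i x -> chart_dom j x ->
  overlap i j (chart_map i x).
Proof. by move=> xi xj; exists x. Qed.

Lemma transitionE i j x : chart_dom i x ->
  transition i j (chart_map i x) = chart_map j x.
Proof. by move=> xi; rewrite transition.unlock/= chart_mapK. Qed.

(** Within the open image of the chart [i], the overlap is the preimage of an open domain under the
    continuous [chart_inv i]. *)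
Lemma overlap_open i j : open (overlap i j).
Proof.
rewrite openE => _ [x [xi xj] <-]; rewrite /interior.
have Ui : (chart_map i @` chart_dom i) (chart_map i x) by exists x.
have invc := chart_inv_continuous Ui.
have djn : nbhs (chart_inv i (chart_map i x)) (chart_dom j).
  by rewrite chart_mapK//; apply: open_nbhs_nbhs; split => //; exact: chart_dom_open.
have Un : nbhs (chart_map i x) (chart_map i @` chart_dom i).
  by apply: open_nbhs_nbhs; split => //; exact: chart_map_open.
apply: filterS2 Un (invc _ djn) => u [y yi <-] /=.
by rewrite chart_mapK// => yj; exists y.
Qed.

Lemma transition_differentiable i j x : chart_dom i x -> chart_dom j x ->
  differentiable (transition i j) (chart_map i x).
Proof.
move=> xi xj; rewrite transition.unlock.
by have [+ _] := @transition_smooth _ _ M i j 1%N; apply; exact: overlapP.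
Qed.

Lemma tjacE i j x v : chart_dom i x -> chart_dom j x ->
  v *m tjac i j x = 'D_v (transition i j) (chart_map i x).
Proof.
move=> xi xj; have := transition_differentiable xi xj.
by rewrite tjac.unlock transition.unlock => /deriveEjacobian ->.
Qed.

(** The chain rule, in this order because vectors are rows. The transition maps compose only over
    the overlap, where [chart_inv] is meaningful; this is a neighbourhood, so derivatives see
    nothing else. *)
Lemma tjac_comp i j k x : chart_dom i x -> chart_dom j x -> chart_dom k x ->
  tjac i k x = tjac i j x *m tjac j k x.
Proof.
move=> xi xj xk; apply/row_matrixP => a; rewrite !rowE mulmxA.
set v := delta_mx 0 a.
rewrite (tjacE v xi xk) (tjacE v xi xj) (tjacE _ xj xk).
have dij := transition_differentiable xi xj.
have djk : differentiable (transition j k) (transition i j (chart_map i x)).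
  by rewrite transitionE//; exact: transition_differentiable.
have := derive_chain v dij djk; rewrite (transitionE j xi) => <-.
apply: near_eq_derive; have o : nbhs (chart_map i x) (overlap i j).
  by apply: open_nbhs_nbhs; split; [exact: overlap_open|exact: overlapP].
apply: filterS o => _ [y [yi yj] <-] /=.
by rewrite !transitionE.
Qed.

Lemma tjac_refl i x : chart_dom i x -> tjac i i x = 1%:M.
Proof.
move=> xi; apply/row_matrixP => a; rewrite !rowE mulmx1.
set v := delta_mx 0 a; rewrite (tjacE v xi xi).
apply: (eq_trans _ (derive_id _ v)); apply: near_eq_derive.
have o : nbhs (chart_map i x) (overlap i i).
  by apply: open_nbhs_nbhs; split; [exact: overlap_open|exact: overlapP].
by apply: filterS o => _ [y [yi _] <-] /=; rewrite transitionE.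
Qed.

Lemma tjacK i j x : chart_dom i x -> chart_dom j x ->
  tjac i j x *m tjac j i x = 1%:M.
Proof. by move=> xi xj; rewrite -tjac_comp// tjac_refl. Qed.

End Transitions.

Section TangentTheory.
Context {R : realType} {n : nat} {M : oriented_riemannian R n}.
Implicit Types (x : M) (i j k : chart M).

Lemma tangent_tjac x (v : tangent x) i j : chart_dom i x -> chart_dom j x ->
  v j = v i *m tjac i j x.
Proof.
by move=> xi xj; rewrite tjac.unlock; case: v => v /= /asboolP[_ H]; exact: H.
Qed.

(** The coordinates in one chart determine those in all charts around the point, and the convention
    of 0 elsewhere settles the remaining ones. *)
Lemma tangent_eq x (v w : tangent x) i : chart_dom i x -> v i = w i -> v = w.
Proof.
move=> xi vw; apply/val_inj/funext => j /=.
case: (pselect (chart_dom j x)) => xj.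
  by rewrite !(tangent_tjac _ xi xj) vw.
by case: v {vw} => v /= /asboolP[-> //]; case: w => w /= /asboolP[-> ].
Qed.

(** The cocycle identity [tjac_comp] makes the transported coordinates compatible. *)
Lemma tangent_exists x i (a : 'rV[R]_n) : chart_dom i x ->
  exists v : tangent x, v i = a.
Proof.
move=> xi.
pose v j := if `[< chart_dom j x >] then a *m tjac i j x else 0.
have vP : v \in tangent_pred x.
  apply/asboolP; split; first by move=> j xj; rewrite /v asboolF.
  move=> j k xj xk; rewrite /v !asboolT// -mulmxA.
  by rewrite (tjac_comp xi xj xk) tjac.unlock.
by exists (Tangent vP); rewrite /= /v asboolT// tjac_refl// mulmx1.
Qed.

Lemma tangentD x (v w : tangent x) i : (v + w) i = v i + w i.
Proof. by []. Qed.
Lemma tangentZ x c (v : tangent x) i : (c *: v) i = c *: v i.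
Proof. by []. Qed.
Lemma tangent0 x i : (0 : tangent x) i = 0.
Proof. by []. Qed.
Lemma tangent_sum x m (v : 'I_m -> tangent x) i : (\sum_k v k) i = \sum_k v k i.
Proof. by elim/big_rec2: _ => // k a b _ <-. Qed.

Lemma chart_atP x : chart_dom (chart_at x) x.
Proof. exact: projT2 (cid (chart_cover x)). Qed.

Lemma innerE x (v w : tangent x) i : chart_dom i x ->
  inner v w = (v i *m metric i (chart_map i x) *m (w i)^T) 0 0.
Proof.
move=> xi; rewrite /inner; have xj := chart_atP x; set j := chart_at x in xj *.
rewrite !(tangent_tjac _ xj xi) (metric_transition xj xi)/=.
by rewrite tjac.unlock trmx_mul !mulmxA.
Qed.

Lemma innerC x (v w : tangent x) : inner v w = inner w v.
Proof.
have xi := chart_atP x; rewrite /inner.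
set A := _ *m _ *m (w _)^T; rewrite -[A]trmxK mxE /A.
by rewrite !trmx_mul trmxK mulmxA Defs.metric_sym.
Qed.

Lemma innerDl x (u v w : tangent x) : inner (u + v) w = inner u w + inner v w.
Proof. by rewrite /inner tangentD !mulmxDl mxE. Qed.
Lemma innerZl x c (v w : tangent x) : inner (c *: v) w = c * inner v w.
Proof. by rewrite /inner tangentZ -!scalemxAl mxE. Qed.
Lemma innerDr x (u v w : tangent x) : inner u (v + w) = inner u v + inner u w.
Proof. by rewrite innerC innerDl innerC [inner w u]innerC. Qed.
Lemma innerZr x c (v w : tangent x) : inner v (c *: w) = c * inner v w.
Proof. by rewrite innerC innerZl innerC. Qed.
Lemma inner0l x (v : tangent x) : inner 0 v = 0.
Proof. by rewrite /inner tangent0 !mul0mx mxE. Qed.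
Lemma inner_suml x m (v : 'I_m -> tangent x) w :
  inner (\sum_k v k) w = \sum_k inner (v k) w.
Proof. by elim/big_rec2: _ => [|k a b _ <-]; rewrite ?inner0l// innerDl. Qed.

Lemma inner_gt0 x (v : tangent x) : v != 0 -> 0 < inner v v.
Proof.
move=> v0; apply: metric_pos; first exact: chart_atP.
apply: contra_neq v0 => vi0; apply: (tangent_eq (chart_atP x)).
by rewrite vi0.
Qed.

Lemma inner_ge0 x (v : tangent x) : 0 <= inner v v.
Proof. by have [->|/inner_gt0/ltW//] := eqVneq v 0; rewrite inner0l. Qed.

Lemma tnorm_gt0 x (v : tangent x) : v != 0 -> 0 < tnorm v.
Proof. by move=> v0; rewrite sqrtr_gt0 inner_gt0. Qed.

Lemma tnorm_sqr x (v : tangent x) : tnorm v * tnorm v = inner v v.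
Proof. by rewrite -expr2 sqr_sqrtr// inner_ge0. Qed.

End TangentTheory.

(** * The Levi-Civita connection *)

Section Christoffel.
Context {R : realType} {n : nat} {M : oriented_riemannian R n}.
Implicit Types (x : M) (i j k : chart M) (X Y Z W : 'rV[R]_n).

(** Treating the symbols as a bilinear map lets their transformation law be derived without
    indices. *)
Definition chris i u X Z : 'rV[R]_n := \row_(k < n) \sum_(a < n) \sum_(b < n)
  christoffel i u a b k * X 0 a * Z 0 b.

Definition dmetric i u X Y W : R := (Y *m 'D_X (@metric _ _ M i) u *m W^T) 0 0.

Lemma metric_differentiable i x : chart_dom i x ->
  differentiable (@metric _ _ M i) (chart_map i x).
Proof. by move=> xi; have [+ _] := @metric_smooth _ _ M i 1%N; apply; exists x. Qed.

Lemma form_sum (P : 'I_n -> 'M[R]_n) X Y W :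
  (Y *m (\sum_c X 0 c *: P c) *m W^T) 0 0 =
  \sum_a \sum_b \sum_l X 0 a * Y 0 b * P a b l * W 0 l.
Proof.
rewrite mulmx_sumr mulmx_suml summxE; apply: eq_bigr => a _.
rewrite -scalemxAr -scalemxAl mxE mxE.
under eq_bigr do rewrite mxE mulr_suml.
rewrite exchange_big/= mulr_sumr; apply: eq_bigr => b _.
rewrite mulr_sumr; apply: eq_bigr => l _; rewrite mxE; ring.
Qed.

Lemma dmetric_sum i x X Y W : chart_dom i x ->
  dmetric i (chart_map i x) X Y W =
  \sum_a \sum_b \sum_l X 0 a * Y 0 b *
    'D_(delta_mx 0 a) (@metric _ _ M i) (chart_map i x) b l * W 0 l.
Proof.
move=> xi; rewrite /dmetric derive_expand; first exact: form_sum.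
exact: metric_differentiable.
Qed.

Lemma metric_unit i x : chart_dom i x -> metric i (chart_map i x) \in unitmx.
Proof.
move=> xi; rewrite -row_free_unit -kermx_eq0; apply/negPn/negP => /rowV0Pn[v].
move=> /sub_kermxP vG v0; have := metric_pos xi v0.
by rewrite vG mul0mx mxE ltxx.
Qed.

(* The Christoffel symbols of the first kind, as a trilinear form. *)
Lemma chris_lower i x X Z W : chart_dom i x -> let u := chart_map i x in
  (chris i u X Z *m metric i u *m W^T) 0 0 =
  2^-1 * (dmetric i u X Z W + dmetric i u Z X W - dmetric i u W X Z).
Proof.
move=> xi u; have Gd := metric_differentiable xi; have Gu := metric_unit xi.
pose P a := 'D_(delta_mx 0 a) (@metric _ _ M i) u.
(* The covector of which [chris] is the image under the inverse metric. *)
pose L : 'rV[R]_n := \row_l (2^-1 * \sum_a \sum_b X 0 a * Z 0 b *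
  (P a b l + P b a l - P l a b)).
have PE a b c : 'D_(delta_mx 0 a) (fun y : 'rV[R]_n => @metric _ _ M i y b c) u = P a b c.
  by rewrite (derive_mxE _ _ _ Gd).
have -> : chris i u X Z = L *m invmx (metric i u).
  apply/rowP => k; rewrite !mxE.
  have invs l : invmx (metric i u) l k = invmx (metric i u) k l.
    by rewrite -[in LHS](Defs.metric_sym xi) -trmx_inv mxE.
  under [RHS]eq_bigr do rewrite mxE invs mulrAC mulr_sumr.
  rewrite [RHS]exchange_big/=; apply: eq_bigr => a _.
  under [RHS]eq_bigr do rewrite mulr_sumr.
  rewrite [RHS]exchange_big/=; apply: eq_bigr => b _.
  rewrite /christoffel mulr_sumr !mulr_suml; apply: eq_bigr => l _.
  rewrite !PE; ring.
rewrite mulmxKV// !dmetric_sum// -/u -/(P _).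
(* All three sums are brought to one indexing: [a] for [X], [b] for [Z], [l] for [W]. *)
have -> : \sum_a \sum_b \sum_l W 0 a * X 0 b * P a b l * Z 0 l =
    \sum_a \sum_b \sum_l W 0 l * X 0 a * P l a b * Z 0 b.
  by rewrite exchange_big/=; apply: eq_bigr => a _; rewrite exchange_big.
have -> : \sum_a \sum_b \sum_l Z 0 a * X 0 b * P a b l * W 0 l =
    \sum_a \sum_b \sum_l Z 0 b * X 0 a * P b a l * W 0 l.
  by rewrite exchange_big.
rewrite mxE -big_split/= -sumrB mulr_sumr.
under eq_bigr do rewrite mxE mulr_sumr mulr_suml.
rewrite exchange_big/=; apply: eq_bigr => a _.
rewrite -big_split/= -sumrB mulr_sumr.
under eq_bigr do rewrite mulr_sumr mulr_suml.
rewrite exchange_big/=; apply: eq_bigr => b _.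
rewrite -big_split/= -sumrB mulr_sumr; apply: eq_bigr => l _.
rewrite !mxE; ring.
Qed.

(** The product rule for a triple product, read along the line through [u] in the direction [X],
    where it concerns functions of one real variable. *)
Lemma derive_form {V : normedModType R} (G G' : V -> 'M[R]_n) (A B : V -> 'rV[R]_n)
    (u X : V) Y W :
  (\forall y \near u, Y *m G y *m W^T = A y *m G' y *m (B y)^T) ->
  differentiable G u -> differentiable G' u ->
  differentiable A u -> differentiable B u ->
  Y *m 'D_X G u *m W^T = 'D_X A u *m G' u *m (B u)^T +
    A u *m 'D_X G' u *m (B u)^T + A u *m G' u *m ('D_X B u)^T.
Proof.
move=> E Gd G'd Ad Bd.
have GX := @deriv_in_line _ _ _ _ _ X Gd.
have G'X := @deriv_in_line _ _ _ _ _ X G'd.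
have AX := @deriv_in_line _ _ _ _ _ X Ad.
have BX := @deriv_in_line _ _ _ _ _ X Bd.
have H1 := deriv_in_mulmx (deriv_in_mulmx (deriv_in_cst setT Y 0) GX)
  (deriv_in_cst setT W^T 0).
have H2 := deriv_in_mulmx (deriv_in_mulmx AX G'X) (deriv_in_trmx BX).
rewrite /= mul0mx add0r mulmx0 addr0 in H1.
rewrite /= scale0r addr0 in H2.
rewrite -mulmxDl; apply: (deriv_setT_unique H1 _).
apply: deriv_in_near H2; last first.
  by rewrite scale0r addr0; exact/esym/(nbhs_singleton E).
have cE : \forall s \near (0 : R), Y *m G (u + s *: X) *m W^T =
    A (u + s *: X) *m G' (u + s *: X) *m (B (u + s *: X))^T := @cvg_line _ _ u X _ E.
by apply: filterS cE => s Es _; split=> //; exact/esym.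
Qed.

Lemma transition_derive_differentiable i j x Y :
  chart_dom i x -> chart_dom j x ->
  differentiable ('D_Y (@transition _ _ M i j)) (chart_map i x).
Proof.
move=> xi xj; rewrite transition.unlock.
have [_ /(_ Y)[+ _]] := @transition_smooth _ _ M i j 2%N.
by apply; exact: overlapP.
Qed.

(* The transformation law of the first derivatives of the metric; the second
   derivatives of the transition map enter through the product rule. *)
Lemma dmetric_transition i j x X Y W : chart_dom i x -> chart_dom j x ->
  let u := chart_map i x in let phi := @transition _ _ M i j in
  let J := tjac i j x in let g := metric j (chart_map j x) in
  dmetric i u X Y W = ('D_X ('D_Y phi) u *m g *m (W *m J)^T) 0 0 +
    dmetric j (chart_map j x) (X *m J) (Y *m J) (W *m J) +
    (Y *m J *m g *m ('D_X ('D_W phi) u)^T) 0 0.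
Proof.
move=> xi xj u phi J g.
have Gd := metric_differentiable xi.
have Gd' : differentiable (@metric _ _ M j) (phi u).
  by rewrite /phi transitionE//; exact: metric_differentiable.
have phid : differentiable phi u := transition_differentiable xi xj.
have := @derive_form _ (@metric _ _ M i) (@metric _ _ M j \o phi)
  ('D_Y phi) ('D_W phi) u X Y W.
have -> : 'D_X (@metric _ _ M j \o phi) u = 'D_(X *m J) (@metric _ _ M j) (chart_map j x).
  by rewrite (derive_chain X phid Gd') /J (tjacE X xi xj) /u /phi (transitionE j xi).
have -> : (@metric _ _ M j \o phi) u = g by rewrite /= /phi transitionE.
rewrite -(tjacE Y xi xj) -(tjacE W xi xj) -/J => H.
rewrite /dmetric H ?mxE//; last first.
- exact: transition_derive_differentiable.
- exact: transition_derive_differentiable.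
- exact: differentiable_comp.
have o : nbhs u (overlap i j).
  by apply: open_nbhs_nbhs; split; [exact: overlap_open|exact: overlapP].
apply: filterS o => _ [y [yi yj] <-] /=.
rewrite -(tjacE Y yi yj) -(tjacE W yi yj) /phi transitionE// trmx_mul.
by rewrite (metric_transition yi yj)/= tjac.unlock !mulmxA.
Qed.

Lemma form_sym i x X Y : chart_dom i x ->
  (X *m metric i (chart_map i x) *m Y^T) 0 0 =
  (Y *m metric i (chart_map i x) *m X^T) 0 0.
Proof.
move=> xi; set A := X *m _ *m _; rewrite -[A]trmxK mxE /A.
by rewrite !trmx_mul trmxK mulmxA Defs.metric_sym.
Qed.

(** Both sides are paired with an arbitrary [W], which by [chris_lower] turns the Christoffel terms
    into derivatives of the metric. In the combination of three such derivatives the second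
    derivatives of the transition map cancel by symmetry, except for two equal terms in [X] and [Y],
    which the factor 1/2 merges into one. The metric being definite, the pairing can be removed. *)
Lemma chris_transition i j x X Y : chart_dom i x -> chart_dom j x ->
  let u := chart_map i x in let J := tjac i j x in
  chris i u X Y *m J =
  'D_X ('D_Y (@transition _ _ M i j)) u + chris j (chart_map j x) (X *m J) (Y *m J).
Proof.
move=> xi xj u J; set phi := @transition _ _ M i j.
have swap V W : 'D_V ('D_W phi) u = 'D_W ('D_V phi) u.
  have o := @overlap_open _ _ M i j.
  apply: (@derive_swap _ _ _ _ (overlap i j) phi u V W o); last exact: overlapP.
  by rewrite /phi transition.unlock; exact: transition_smooth.
(* Of the second derivative only its symmetry and its part in [dmetric_transition] are kept. *)
have [H2 [-> {}swap dm]] : exists H2 : 'rV[R]_n -> 'rV[R]_n -> 'rV[R]_n,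
  [/\ 'D_X ('D_Y phi) u = H2 X Y, (forall V W, H2 V W = H2 W V) & forall X Y W,
    dmetric i u X Y W = (H2 X Y *m metric j (chart_map j x) *m (W *m J)^T) 0 0 +
    dmetric j (chart_map j x) (X *m J) (Y *m J) (W *m J) +
    (Y *m J *m metric j (chart_map j x) *m (H2 X W)^T) 0 0].
  exists (fun V W => 'D_V ('D_W phi) u); split=> // X' Y' W.
  exact: dmetric_transition.
set H := H2 X Y; set C := chris j _ _ _; set g := metric j (chart_map j x).
have low W : ((chris i u X Y *m J - (H + C)) *m g *m (W *m J)^T) 0 0 = 0.
  have -> : ((chris i u X Y *m J - (H + C)) *m g *m (W *m J)^T) 0 0 =
      (chris i u X Y *m metric i u *m W^T) 0 0 - (H *m g *m (W *m J)^T) 0 0 -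
      (C *m g *m (W *m J)^T) 0 0.
    rewrite (metric_transition xi xj)/= -/u -/g.
    have -> : jacobian (chart_map j \o chart_inv i) u = J by rewrite /J tjac.unlock.
    by rewrite trmx_mul opprD addrA !mulmxBl !mulmxA !mxE.
  rewrite chris_lower// /C chris_lower// !dm -/g -/H.
  rewrite (swap Y X) -/H (swap W X) (swap W Y).
  rewrite (form_sym (Y *m J) (H2 X W) xj) -/g.
  move: ((H *m g *m _) 0 0) ((H2 X W *m g *m _) 0 0) ((X *m J *m g *m _) 0 0).
  move: (dmetric _ _ (X *m J) _ _) (dmetric _ _ (Y *m J) _ _) (dmetric _ _ (W *m J) _ _).
  by move=> a b c d e f; field.
apply/eqP; rewrite -subr_eq0; apply/negPn/negP => d0.
(* [W] is the difference pulled back to the chart [i], so that [W *m J] is the difference itself and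
   its square would be both positive and 0. *)
have := metric_pos xj d0; have := low ((chris i u X Y *m J - (H + C)) *m tjac j i x).
have -> : (chris i u X Y *m J - (H + C)) *m tjac j i x *m J = chris i u X Y *m J - (H + C).
  by rewrite -[LHS]mulmxA (tjacK xj xi) mulmx1.
by rewrite -/g => ->; rewrite ltxx.
Qed.

End Christoffel.

(** * Covariant derivatives along a curve *)

Section Curves.
Context {R : realType} {n : nat} {M : oriented_riemannian R n}.
Context (tau : R) (htau : 0 < tau).
Implicit Types (i j : chart M) (x : R -> M) (t : R).

(** No point of the interval is isolated in it: there are nearby points to the right of [t] if
    [t < tau], and to the left otherwise. Hence relative derivatives are unique, end points
    included. *)
Lemma proper_itv t : t \in `[0, tau] -> ProperFilter (within `[0, tau] t^').
Proof.
rewrite in_itv/= => /andP[t0 tt]; split; last exact: within_filter.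
rewrite /within/= => /nbhs_ballP[d /= d0 dP].
have [tlt|tge] := ltP t tau.
  pose s := t + Num.min (d / 2) (tau - t).
  have m0 : 0 < Num.min (d / 2) (tau - t) by rewrite lt_min divr_gt0// subr_gt0.
  have := dP s; rewrite /ball/= opprD addrA subrr sub0r normrN gtr0_norm//.
  apply.
  - by rewrite gt_min ltr_pdivrMr// ltr_pMr// ltr1n.
  - by rewrite -subr_eq0 addrAC subrr add0r gt_eqF.
  - by rewrite in_itv/= (addr_ge0 t0 (ltW m0))/= /s addrC -lerBrDr ge_min lexx orbT.
pose s := t - Num.min (d / 2) tau.
have m0 : 0 < Num.min (d / 2) tau by rewrite lt_min divr_gt0.
have := dP s; rewrite /ball/= opprB addrCA subrr addr0 gtr0_norm//.
apply.
- by rewrite gt_min ltr_pdivrMr// ltr_pMr// ltr1n.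
- by rewrite -subr_eq0 addrAC subrr sub0r oppr_eq0 gt_eqF.
- rewrite in_itv/= subr_ge0 (le_trans _ tge) ?ge_min ?lexx ?orbT//=.
  by rewrite (le_trans _ tt)// gerBl ltW.
Qed.

Definition chart_times x i : set R := `[0, tau] `&` x @^-1` chart_dom i.

Lemma near_chart x i t : continuous_curve tau x -> t \in `[0, tau] ->
  chart_dom i (x t) -> \forall s \near t, `[0, tau]%classic s -> chart_dom i (x s).
Proof.
move=> /subspace_continuousP xc tI xi.
have : nbhs (x t) (chart_dom i).
  by apply: open_nbhs_nbhs; split => //; exact: chart_dom_open.
move=> /(xc t tI) H.
by have : \forall s \near within `[0, tau] (nbhs t), chart_dom i (x s) := H.
Qed.

(** By continuity of the curve its chart times form a relative neighbourhood of [t]. This links the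
    C^k conditions, stated chart by chart, to velocities and covariant derivatives, stated on the
    whole interval. *)
Lemma deriv_chart_times {V : normedModType R} x i t (f : R -> V) l :
  continuous_curve tau x -> chart_times x i t ->
  is_deriv_in (chart_times x i) f t l <-> is_deriv_in `[0, tau] f t l.
Proof.
move=> xc [tI xi]; have nc := near_chart xc tI xi; split.
  by apply: deriv_in_near => //; apply: filterS nc => s H sI; split=> //; split=> //; exact: H.
by apply: deriv_in_near => //; near=> s => -[].
Unshelve. all: by end_near. Qed.

Lemma is_velocity_unique x t (v w : tangent (x t)) : t \in `[0, tau] ->
  is_velocity tau v -> is_velocity tau w -> v = w.
Proof.
move=> tI vP wP; have xi := chart_atP (x t); apply: (tangent_eq xi).
apply: deriv_in_unique (vP _ xi) (wP _ xi); exact: proper_itv.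
Qed.

Lemma velocityE x t (v : tangent (x t)) : t \in `[0, tau] ->
  is_velocity tau v -> velocity tau x t = v.
Proof.
by move=> tI vP; apply: xget_unique => // w wP; exact: is_velocity_unique vP.
Qed.

Lemma is_velocity_exists x t i a : continuous_curve tau x ->
  t \in `[0, tau] -> chart_dom i (x t) ->
  is_deriv_in `[0, tau] (chart_map i \o x) t a ->
  exists2 v : tangent (x t), v i = a & is_velocity tau v.
Proof.
move=> xc tI xi xa; have [v va] := tangent_exists a xi; exists v => // j xj.
have phid := transition_differentiable xi xj.
have := deriv_in_comp phid xa.
rewrite -deriveE// -(tjacE a xi xj) -va -tangent_tjac//.
apply: deriv_in_near; last by rewrite /= transitionE.
by apply: filterS (near_chart xc tI xi) => s H sI; split=> //=; rewrite transitionE//; exact: H.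
Qed.

Lemma is_covariant_unique x (Z : forall t, tangent (x t)) t (v w : tangent (x t)) :
  t \in `[0, tau] -> is_covariant tau Z v -> is_covariant tau Z w -> v = w.
Proof.
move=> tI vP wP; have xi := chart_atP (x t); apply: (tangent_eq xi).
have [dz dzP ->] := vP _ xi; have [dz' dzP' ->] := wP _ xi.
by rewrite (deriv_in_unique (proper_itv tI) dzP dzP').
Qed.

Lemma covariantE x (Z : forall t, tangent (x t)) t (v : tangent (x t)) :
  t \in `[0, tau] -> is_covariant tau Z v -> covariant tau Z t = v.
Proof.
by move=> tI vP; apply: xget_unique => // w wP; exact: is_covariant_unique vP.
Qed.

Lemma derive2_expand i j (p : M) (v z : 'rV[R]_n) : chart_dom i p -> chart_dom j p ->
  'D_v ('D_z (@transition _ _ M i j)) (chart_map i p) =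
  \sum_a z 0 a *: 'D_v ('D_(delta_mx 0 a) (@transition _ _ M i j)) (chart_map i p).
Proof.
move=> pi pj; set phi := @transition _ _ M i j; set u := chart_map i p.
have phid a : differentiable ('D_(delta_mx 0 a) phi) u.
  exact: transition_derive_differentiable.
have H1 := @deriv_in_line _ _ _ _ _ v (transition_derive_differentiable z pi pj).
have H2 : is_deriv_in setT (fun s => \sum_a z 0 a *: 'D_(delta_mx 0 a) phi (u + s *: v)) 0
    (\sum_a z 0 a *: 'D_v ('D_(delta_mx 0 a) phi) u).
  apply: deriv_in_sum => a.
  have := deriv_inZ (deriv_in_cst setT (z 0 a : R) 0) (@deriv_in_line _ _ _ _ _ v (phid a)).
  by rewrite scale0r add0r.
apply: (deriv_setT_unique H1 _).
have o : nbhs u (overlap i j).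
  by apply: open_nbhs_nbhs; split; [exact: overlap_open|exact: overlapP].
have e y : overlap i j y -> \sum_a z 0 a *: 'D_(delta_mx 0 a) phi y = 'D_z phi y.
  by move=> [q [qi qj] <-]; rewrite [RHS]derive_expand//; exact: transition_differentiable.
apply: deriv_in_near H2; last first.
  by apply: e; rewrite scale0r addr0; exact: overlapP.
have co : \forall s \near (0 : R), overlap i j (u + s *: v) := @cvg_line _ _ u v _ o.
by apply: filterS co => s os _; split=> //; exact: e.
Qed.

(** Differentiability in one chart suffices. In the chart [j] the field is the derivative of the
    transition map in the direction of its coordinates in [i], so the product rule produces a second
    derivative of the transition map; it is the inhomogeneous term of [chris_transition], with the
    opposite effect. *)
Lemma is_covariant_exists x (Z : forall t, tangent (x t)) t i dz :
  continuous_curve tau x -> t \in `[0, tau] -> chart_dom i (x t) ->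
  is_velocity tau (velocity tau x t) ->
  is_deriv_in `[0, tau] (fun s => Z s i) t dz ->
  exists2 w : tangent (x t), is_covariant tau Z w &
    w i = dz + chris i (chart_map i (x t)) (velocity tau x t i) (Z t i).
Proof.
move=> xc tI xi vP Zd; set v := velocity tau x t in vP *.
have [w wi] := tangent_exists (dz + chris i (chart_map i (x t)) (v i) (Z t i)) xi.
exists w => // j xj.
exists (dz *m tjac i j (x t) +
    'D_(v i) ('D_(Z t i) (@transition _ _ M i j)) (chart_map i (x t))); last first.
  rewrite (tangent_tjac w xi xj) wi mulmxDl chris_transition// -addrA.
  by rewrite -(tangent_tjac v xi xj) -(tangent_tjac (Z t) xi xj).
pose phi := @transition _ _ M i j; pose u := chart_map i (x t).
have H : is_deriv_in `[0, tau]
    (fun s => \sum_a Z s i 0 a *: 'D_(delta_mx 0 a) phi (chart_map i (x s))) t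
    (\sum_a (dz 0 a *: 'D_(delta_mx 0 a) phi u +
      Z t i 0 a *: 'D_(v i) ('D_(delta_mx 0 a) phi) u)).
  apply: deriv_in_sum => a; apply: deriv_inZ.
    by have /deriv_in_mxP := Zd; exact.
  have phid : differentiable ('D_(delta_mx 0 a) phi) u.
    exact: transition_derive_differentiable.
  by have := deriv_in_comp phid (vP _ xi); rewrite -deriveE.
have -> : dz *m tjac i j (x t) + 'D_(v i) ('D_(Z t i) phi) u =
    \sum_a (dz 0 a *: 'D_(delta_mx 0 a) phi u +
      Z t i 0 a *: 'D_(v i) ('D_(delta_mx 0 a) phi) u).
  rewrite big_split/=; congr (_ + _); last exact: derive2_expand.
  by rewrite (tjacE dz xi xj); apply: derive_expand; exact: transition_differentiable.
have e s : chart_dom i (x s) -> chart_dom j (x s) ->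
    \sum_a Z s i 0 a *: 'D_(delta_mx 0 a) phi (chart_map i (x s)) = Z s j.
  move=> si sj; rewrite (tangent_tjac (Z s) si sj) (tjacE (Z s i) si sj).
  by apply/esym; apply: derive_expand; exact: transition_differentiable.
apply: deriv_in_near H; last exact: e.
apply: filterS2 (near_chart xc tI xi) (near_chart xc tI xj) => s Hi Hj sI.
by split=> //; apply: e; [exact: Hi|exact: Hj].
Qed.

Lemma velocityP k x t : Ck_curve tau k.+1 x -> t \in `[0, tau] ->
  is_velocity tau (velocity tau x t).
Proof.
move=> [xc xk] tI; have xi := chart_atP (x t); have [f' ff' _] := xk (chart_at (x t)).
have := ff' t (conj tI xi); rewrite deriv_chart_times// => fd.
by have [v _ vP] := is_velocity_exists xc tI xi fd; rewrite (velocityE tI vP).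
Qed.

Definition Ck_field k x (Z : forall t, tangent (x t)) : Prop :=
  forall i, Ck_in k (chart_times x i) (fun t => Z t i).

(** A scalar refers to no chart, but is tested on the same parameter sets as the coordinates of
    fields, so that the two can be multiplied. *)
Definition Ck_scalar k x (c : R -> R) : Prop :=
  forall i, Ck_in k (chart_times x i) c.

Lemma Ck_velocity k x : Ck_curve tau k.+1 x -> Ck_field k (velocity tau x).
Proof.
move=> xk i; have [xc /(_ i)[f' ff' f'k]] := xk.
apply: Ck_in_eq f'k => t ti; have [tI xi] := ti.
have /(_ i xi) vd := velocityP xk tI; apply: deriv_in_unique (proper_itv tI) _ vd.
by rewrite -(deriv_chart_times _ _ xc ti); exact: ff'.
Qed.

Lemma covariantP x (Z : forall t, tangent (x t)) t : continuous_curve tau x ->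
  t \in `[0, tau] -> is_velocity tau (velocity tau x t) -> Ck_field 1 Z ->
  is_covariant tau Z (covariant tau Z t).
Proof.
move=> xc tI vP Z1; have xi := chart_atP (x t); have [f' ff' _] := Z1 (chart_at (x t)).
have := ff' t (conj tI xi); rewrite deriv_chart_times// => fd.
by have [w wP _] := is_covariant_exists xc tI xi vP fd; rewrite (covariantE tI wP).
Qed.

Lemma Ck_metric k x i : Ck_curve tau k x ->
  Ck_in k (chart_times x i) (@metric _ _ M i \o (chart_map i \o x)).
Proof.
move=> [_ xk]; apply: (@Ck_in_comp _ _ _ _ _ _ (chart_map i @` chart_dom i)) (xk i).
  by move=> t [_ xi]; exists (x t).
exact: metric_smooth.
Qed.

Lemma Ck_chris k x (X Z : forall t, tangent (x t)) i : Ck_curve tau k x ->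
  Ck_field k X -> Ck_field k Z ->
  Ck_in k (chart_times x i) (fun t => chris i (chart_map i (x t)) (X t i) (Z t i)).
Proof.
move=> xC /(_ i)/Ck_in_mxP Xk /(_ i)/Ck_in_mxP Zk; have [xc /(_ i) xk] := xC.
have sub t : chart_times x i t -> (chart_map i @` chart_dom i) ((chart_map i \o x) t).
  by move=> [_ xi]; exists (x t).
have gk := Ck_metric i xC.
have gu t : chart_times x i t -> (@metric _ _ M i \o (chart_map i \o x)) t \in unitmx.
  by move=> [_ xi]; exact: metric_unit.
have ginv := Ck_in_invmx gu gk.
have dgk c : Ck_in k (chart_times x i)
    ('D_(delta_mx 0 c) (@metric _ _ M i) \o (chart_map i \o x)).
  apply: (Ck_in_comp sub) xk.
  by have [_] := @metric_smooth _ _ M i k.+1; apply.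
have dgE c a b t : chart_times x i t ->
    'D_(delta_mx 0 c) (fun y : 'rV[R]_n => @metric _ _ M i y a b) (chart_map i (x t)) =
    'D_(delta_mx 0 c) (@metric _ _ M i) (chart_map i (x t)) a b.
  by move=> [_ xi]; apply: derive_mxE; exact: metric_differentiable.
apply/Ck_in_mxP => z k'; rewrite (ord1 z).
apply: (@Ck_in_eq R _ _ _ (fun t => \sum_a \sum_b
  (2^-1 * \sum_l invmx (metric i (chart_map i (x t))) k' l *
    ('D_(delta_mx 0 a) (@metric _ _ M i) (chart_map i (x t)) b l +
     'D_(delta_mx 0 b) (@metric _ _ M i) (chart_map i (x t)) a l -
     'D_(delta_mx 0 l) (@metric _ _ M i) (chart_map i (x t)) a b)) *
  X t i 0 a * Z t i 0 b)).
  move=> t ti; rewrite mxE; apply: eq_bigr => a _; apply: eq_bigr => b _.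
  congr (_ * _ * _); rewrite /christoffel; congr (_ * _); apply: eq_bigr => l _.
  by rewrite !dgE.
apply: Ck_in_sum => a; apply: Ck_in_sum => b.
apply: Ck_inM; last exact: Zk.
apply: Ck_inM; last exact: Xk.
apply: Ck_inM; first exact: Ck_in_cst.
apply: Ck_in_sum => l; apply: Ck_inM.
  by have /Ck_in_mxP := ginv; exact.
apply: Ck_inD; last apply: Ck_inN.
  apply: Ck_inD; first by have /Ck_in_mxP := dgk a; exact.
  by have /Ck_in_mxP := dgk b; exact.
by have /Ck_in_mxP := dgk l; exact.
Qed.

Lemma Ck_fieldW m k x (Z : forall t, tangent (x t)) : (m <= k)%N ->
  Ck_field k Z -> Ck_field m Z.
Proof. by move=> mk Zk i; exact: Ck_in_le mk (Zk i). Qed.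

Lemma Ck_curveW m k x : (m <= k)%N -> Ck_curve tau k x -> Ck_curve tau m x.
Proof. by move=> mk [xc xk]; split=> // i; exact: Ck_in_le mk (xk i). Qed.

Lemma Ck_covariant k x (Z : forall t, tangent (x t)) : Ck_curve tau k.+1 x ->
  Ck_field k.+1 Z -> Ck_field k (covariant tau Z).
Proof.
move=> xk Zk i; have [xc _] := xk; have [f' ff' f'k] := Zk i.
apply: (@Ck_in_eq _ _ _ _ (fun t => f' t +
  chris i (chart_map i (x t)) (velocity tau x t i) (Z t i))).
  move=> t ti; have [tI xi] := ti.
  have Z1 : Ck_field 1 Z by exact: Ck_fieldW Zk.
  have [dz dzP ->] := covariantP xc tI (velocityP xk tI) Z1 xi.
  congr (_ + _); apply: deriv_in_unique (proper_itv tI) _ dzP.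
  by rewrite -(deriv_chart_times _ _ xc ti); exact: ff'.
apply: Ck_inD => //; apply: Ck_chris; [exact: Ck_curveW xk|exact: Ck_velocity|].
exact: Ck_fieldW Zk.
Qed.

Lemma chrisDr i u (X Y Z : 'rV[R]_n) :
  chris i u X (Y + Z) = chris i u X Y + @chris _ _ M i u X Z.
Proof.
apply/rowP => k; rewrite !mxE -big_split; apply: eq_bigr => a _ /=.
by rewrite -big_split; apply: eq_bigr => b _ /=; rewrite mxE mulrDr.
Qed.

Lemma chrisZr i u c (X Y : 'rV[R]_n) :
  chris i u X (c *: Y) = c *: @chris _ _ M i u X Y.
Proof.
apply/rowP => k; rewrite !mxE mulr_sumr; apply: eq_bigr => a _ /=.
by rewrite mulr_sumr; apply: eq_bigr => b _ /=; rewrite mxE mulrCA.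
Qed.

Lemma is_covariantD x (Y Z : forall t, tangent (x t)) t (v w : tangent (x t)) :
  is_covariant tau Y v -> is_covariant tau Z w ->
  is_covariant tau (fun s => Y s + Z s) (v + w).
Proof.
move=> Yv Zw i xi; have [dy dyP vE] := Yv i xi; have [dz dzP wE] := Zw i xi.
exists (dy + dz); first exact: deriv_inD.
by rewrite tangentD vE wE -/(chris _ _ _ _) -/(chris _ _ _ (Z t i))
  -/(chris _ _ _ ((Y t + Z t) i)) tangentD chrisDr addrACA.
Qed.

Lemma is_covariantZ x (c : R -> R) (Z : forall t, tangent (x t)) t k (w : tangent (x t)) :
  is_deriv_in `[0, tau] c t k -> is_covariant tau Z w ->
  is_covariant tau (fun s => c s *: Z s) (k *: Z t + c t *: w).
Proof.
move=> ck Zw i xi; have [dz dzP wE] := Zw i xi.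
exists (k *: Z t i + c t *: dz); first exact: deriv_inZ.
by rewrite tangentD !tangentZ wE -/(chris _ _ _ (Z t i))
  -/(chris _ _ _ ((c t *: Z t) i)) tangentZ chrisZr scalerDr addrA.
Qed.

Lemma is_covariant0 x t : is_covariant tau (fun s => 0 : tangent (x s)) (0 : tangent (x t)).
Proof.
move=> i xi; exists 0; first exact: deriv_in_cst.
rewrite -/(chris _ _ _ 0) -[X in chris _ _ _ X](scale0r (0 : 'rV[R]_n)).
by rewrite chrisZr scale0r addr0.
Qed.

Lemma is_covariant_sum x m (Z : 'I_m -> forall t, tangent (x t)) t (w : 'I_m -> tangent (x t)) :
  (forall k, is_covariant tau (Z k) (w k)) ->
  is_covariant tau (fun s => \sum_k Z k s) (\sum_k w k).
Proof.
elim: m Z w => [|m IHm] Z w H.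
  have -> : (fun s => \sum_(k < 0) Z k s) = fun s => 0.
    by apply/functional_extensionality_dep => s; rewrite big_ord0.
  by rewrite big_ord0; exact: is_covariant0.
have -> : (fun s => \sum_k Z k s) = fun s => Z ord0 s + \sum_(k < m) Z (lift ord0 k) s.
  by apply/functional_extensionality_dep => s; rewrite big_ord_recl.
by rewrite big_ord_recl; apply: is_covariantD => //; exact: IHm.
Qed.

(** The Gram matrix is symmetric over the image of the chart; this is open, so the derivative of the
    matrix is symmetric too. *)
Lemma dmetric_sym i (p : M) (X Y W : 'rV[R]_n) : chart_dom i p ->
  dmetric i (chart_map i p) X Y W = dmetric i (chart_map i p) X W Y.
Proof.
move=> pi; rewrite /dmetric.
have gd := metric_differentiable pi.
have gT : ('D_X (@metric _ _ M i) (chart_map i p))^T = 'D_X (@metric _ _ M i) (chart_map i p).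
  apply/matrixP => a b; rewrite mxE -[LHS](derive_mxE _ _ _ gd) -[RHS](derive_mxE _ _ _ gd).
  apply: near_eq_derive.
  have o : nbhs (chart_map i p) (chart_map i @` chart_dom i).
    by apply: open_nbhs_nbhs; split; [exact: chart_map_open|exists p].
  by apply: filterS o => _ [q qi <-]; rewrite -[in LHS](Defs.metric_sym qi) mxE.
set A := Y *m _ *m _; rewrite -[A]trmxK mxE /A.
by rewrite !trmx_mul trmxK mulmxA gT.
Qed.

(** The connection is compatible with the metric: in the sum of the two Christoffel terms the
    derivatives of the metric in the directions of [Y] and [Z] cancel, and the derivative along the
    velocity remains. *)
Lemma is_deriv_inner x (Y Z : forall t, tangent (x t)) t (v w : tangent (x t)) :
  continuous_curve tau x -> t \in `[0, tau] ->
  is_velocity tau (velocity tau x t) ->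
  is_covariant tau Y v -> is_covariant tau Z w ->
  is_deriv_in `[0, tau] (fun s => inner (Y s) (Z s)) t (inner v (Z t) + inner (Y t) w).
Proof.
move=> xc tI vP Yv Zw; have xi := chart_atP (x t); set i := chart_at (x t) in xi.
have [dy dyP vE] := Yv i xi; have [dz dzP wE] := Zw i xi.
set X := velocity tau x t in vP vE wE; set u := chart_map i (x t) in vE wE.
have gd := metric_differentiable xi.
have gP := deriv_in_comp gd (vP i xi); rewrite -deriveE// in gP.
have := deriv_in_mulmx (deriv_in_mulmx dyP gP) (deriv_in_trmx dzP).
move=> /deriv_in_mxP/(_ 0 0)/=.
have addE (A B : 'M[R]_1) : (A + B) 0 0 = A 0 0 + B 0 0 by rewrite mxE.
rewrite mulmxDl !addE [X in is_deriv_in _ _ _ X -> _](_ : _ = inner v (Z t) + inner (Y t) w).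
  apply: deriv_in_near; last by rewrite (innerE _ _ xi).
  apply: filterS (near_chart xc tI xi) => s H sI; split=> //.
  by rewrite (innerE _ _ (H sI)).
rewrite !(innerE _ _ xi) vE wE -/(chris _ _ _ _) -/(chris _ _ _ (Z t i)) -/u.
rewrite !mulmxDl linearD/= mulmxDr !addE.
rewrite -/(dmetric i u (X i) (Y t i) (Z t i)).
have -> : (Y t i *m metric i u *m (chris i u (X i) (Z t i))^T) 0 0 =
  (chris i u (X i) (Z t i) *m metric i u *m (Y t i)^T) 0 0 by exact: form_sym.
rewrite !chris_lower// (dmetric_sym (X i) (Z t i) (Y t i) xi) -/u.
move: ((dy *m _ *m _) 0 0) ((Y t i *m _ *m dz^T) 0 0) => a b.
move: (dmetric i u (X i) _ _) (dmetric i u (Y t i) _ _) (dmetric i u (Z t i) _ _).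
by move=> c d e; field.
Qed.

End Curves.

(** * Orthonormal frames *)

Section Frames.
Context {R : realType} {n : nat} {M : oriented_riemannian R n}.
Implicit Types (p : M) (i j : chart M).

Definition frame_mx p i (b : 'I_n -> tangent p) : 'M[R]_n := \matrix_(k < n) b k i.

Lemma frame_mx_gram p i (b : 'I_n -> tangent p) : chart_dom i p ->
  frame_mx i b *m metric i (chart_map i p) *m (frame_mx i b)^T =
  \matrix_(k, l) inner (b k) (b l).
Proof.
move=> pi; apply/matrixP => k l; rewrite [RHS]mxE (innerE _ _ pi).
rewrite -[b k i](rowK (fun k => b k i)) -[b l i](rowK (fun k => b k i)).
by rewrite -/(frame_mx i b) tr_row -row_mul !mxE; apply: eq_bigr => a _; rewrite !mxE.
Qed.

Lemma orthonormal_frame_mx p i (b : 'I_n -> tangent p) : chart_dom i p ->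
  orthonormal_family b ->
  frame_mx i b *m (metric i (chart_map i p) *m (frame_mx i b)^T) = 1%:M.
Proof.
move=> pi ob; rewrite mulmxA frame_mx_gram//; apply/matrixP => k l.
by rewrite !mxE ob.
Qed.

(** A one-sided inverse of a square matrix is two-sided, so [n] orthonormal vectors span. *)
Lemma orthonormal_expand p (b : 'I_n -> tangent p) v : orthonormal_family b ->
  v = \sum_k inner v (b k) *: b k.
Proof.
move=> ob; have pi := chart_atP p; apply: (tangent_eq pi).
set i := chart_at p in pi *; have := orthonormal_frame_mx pi ob.
move=> /mulmx1C H; rewrite -[LHS]mulmx1 -H tangent_sum mulmxA.
rewrite [RHS](_ : _ = \sum_k inner v (b k) *: row k (frame_mx i b)); last first.
  by apply: eq_bigr => k _; rewrite tangentZ rowK.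
rewrite mulmx_sum_row; apply: eq_bigr => k _; congr (_ *: _).
rewrite (innerE _ _ pi) mulmxA !mxE; apply: eq_bigr => a _.
by rewrite !mxE.
Qed.

Lemma positively_orientedE p i (b : 'I_n -> tangent p) : chart_dom i p ->
  positively_oriented b <-> 0 < \det (frame_mx i b).
Proof.
move=> pi; have pj := chart_atP p; rewrite /positively_oriented.
have E : frame_mx i b = \matrix_(k < n) b k (chart_at p) *m tjac (chart_at p) i p.
  apply/row_matrixP => k; rewrite row_mul !rowK.
  exact: tangent_tjac.
rewrite E det_mulmx; have := transition_oriented pj pi.
rewrite -[jacobian _ _](_ : tjac (chart_at p) i p = _); last by rewrite tjac.unlock.
by move=> d0; rewrite pmulr_lgt0.
Qed.

(** Determinants in [F g F^T = 1] give the square; the orientation selects the root. *)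
Lemma sqrt_det_metric p i (b : 'I_n -> tangent p) : chart_dom i p ->
  orthonormal_family b -> positively_oriented b ->
  Num.sqrt (\det (metric i (chart_map i p))) = (\det (frame_mx i b))^-1.
Proof.
move=> pi ob pb; have := congr1 determinant (orthonormal_frame_mx pi ob).
have d0 : 0 < \det (frame_mx i b) by exact/positively_orientedE.
rewrite !det_mulmx det_tr det1 => E.
have -> : \det (metric i (chart_map i p)) = (\det (frame_mx i b))^-1 ^+ 2.
  apply: (mulfI (lt0r_neq0 d0)); apply: (mulIf (lt0r_neq0 d0)).
  by rewrite -mulrA E; field; rewrite gt_eqF.
by rewrite sqrtr_sqr ger0_norm// invr_ge0 ltW.
Qed.

(* As [F g F^T = 1] for the frame matrix [F], the adjugate of [F] is
   [\det F *: g F^T]; its [l]-th column only involves the other rows of [F], so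
   this exhibits the last frame vector as a smooth function of the others. *)
Lemma frame_last p i (b : 'I_n -> tangent p) (l : 'I_n) : chart_dom i p ->
  orthonormal_family b -> positively_oriented b ->
  b l i = Num.sqrt (\det (metric i (chart_map i p))) *:
    (\row_a cofactor (frame_mx i b) l a *m invmx (metric i (chart_map i p))).
Proof.
move=> pi ob pb; rewrite (sqrt_det_metric pi ob pb).
have d0 : 0 < \det (frame_mx i b) by exact/positively_orientedE.
set F := frame_mx i b in d0 *; set g := metric _ _.
have Fu : F \in unitmx by rewrite unitmxE unitfE gt_eqF.
have -> : \row_a cofactor F l a = \det F *: (b l i *m g).
  have : \adj F = \det F *: (g *m F^T).
    rewrite -[LHS]mulmx1 -(orthonormal_frame_mx pi ob) -/F -/g [LHS]mulmxA mul_adj_mx.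
    by rewrite mul_scalar_mx.
  move=> /matrixP E; apply/rowP => a; rewrite !mxE; have := E a l; rewrite !mxE => ->.
  congr (_ * _); apply: eq_bigr => c _; rewrite !mxE mulrC.
  by congr (_ * _); rewrite /g -[in LHS](Defs.metric_sym pi) mxE.
rewrite -scalemxAl scalerA mulVf ?gt_eqF// scale1r mulmxK//.
exact: metric_unit.
Qed.

Lemma cofactor_row_eq (F G : 'M[R]_n) l a : (forall k, k != l -> row k F = row k G) ->
  cofactor F l a = cofactor G l a.
Proof.
move=> FG; rewrite /cofactor; congr (_ * \det _).
apply/matrixP => k c; rewrite !mxE.
have lk : lift l k != l by rewrite eq_sym neq_lift.
have /rowP/(_ (lift a c)) := FG _ lk.
by rewrite !mxE.
Qed.

Lemma orthonormal_last_unique p (b b' : 'I_n -> tangent p) l :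
  (forall k, k != l -> b k = b' k) ->
  orthonormal_family b -> positively_oriented b ->
  orthonormal_family b' -> positively_oriented b' -> b l = b' l.
Proof.
move=> bb' ob pb ob' pb'; have pi := chart_atP p; apply: (tangent_eq pi).
rewrite (frame_last l pi ob pb) (frame_last l pi ob' pb'); congr (_ *: (_ *m _)).
apply/rowP => a; rewrite !mxE; apply: cofactor_row_eq => k kl.
by rewrite !rowK bb'.
Qed.

(** A unit vector orthogonal to the others completes the family. Orthonormality makes the
    determinant nonzero, and changing the sign of the new vector corrects the orientation. *)
Lemma orthonormal_last_exists p (b : 'I_n -> tangent p) l :
  (forall k k', k != l -> k' != l -> inner (b k) (b k') = (k == k')%:R) ->
  exists w, let b' k := if k == l then w else b k in
    orthonormal_family b' /\ positively_oriented b'.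
Proof.
move=> ob; have pi := chart_atP p; set i := chart_at p in pi; set g := metric i (chart_map i p).
(* The zero row makes [g *m K^T] singular; a nonzero vector of its kernel is orthogonal to all [b k]
   with [k != l]. *)
pose K : 'M[R]_n := \matrix_(k < n) (if k == l then 0 else b k i).
have : kermx (g *m K^T) != 0.
  rewrite kermx_eq0 row_free_unit unitmxE det_mulmx det_tr.
  by rewrite (expand_det_row K l) big1 ?mulr0 ?unitr0// => a _; rewrite mxE eqxx mxE mul0r.
move=> /rowV0Pn[v /sub_kermxP vK v0].
have [w0 w0i] := tangent_exists v pi.
have w0n0 : w0 != 0 by apply: contra_neq v0 => w00; rewrite -w0i w00.
have w0b k : k != l -> inner w0 (b k) = 0.
  move=> kl; rewrite (innerE _ _ pi) w0i -/g; move: vK => /rowP/(_ k).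
  rewrite mulmxA [X in _ = X]mxE => <-; rewrite !mxE.
  by apply: eq_bigr => a _; rewrite !mxE (negbTE kl).
pose w1 := (tnorm w0)^-1 *: w0.
have nw0 := lt0r_neq0 (tnorm_gt0 w0n0).
have w1w1 : inner w1 w1 = 1.
  by rewrite /w1 innerZl innerZr -tnorm_sqr; field.
have w1b k : k != l -> inner w1 (b k) = 0.
  by move=> kl; rewrite innerZl w0b// mulr0.
have on c : c * c = 1 -> orthonormal_family (fun k => if k == l then c *: w1 else b k).
  move=> cc k k'; have [k1|kl] := boolP (k == l); have [k1'|kl'] := boolP (k' == l).
  - by rewrite innerZl innerZr w1w1 mulr1 cc (eqP k1) (eqP k1') eqxx.
  - by rewrite innerZl w1b// mulr0 (eqP k1) eq_sym (negbTE kl').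
  - by rewrite innerC innerZl w1b// mulr0 (eqP k1') (negbTE kl).
  - exact: ob.
pose b1 k := if k == l then w1 else b k.
have dE c : \det (frame_mx i (fun k => if k == l then c *: w1 else b k)) =
    c * \det (frame_mx i b1).
  rewrite (expand_det_row _ l) [in RHS](expand_det_row _ l) mulr_sumr.
  apply: eq_bigr => a _; rewrite [RHS]mulrA; congr (_ * _).
    by rewrite !mxE /b1 eqxx tangentZ mxE.
  by apply: cofactor_row_eq => k kl; rewrite !rowK /b1 (negbTE kl).
have o1 := on 1 (mulr1 1).
have d1 : \det (frame_mx i b1) != 0.
  have := congr1 determinant (orthonormal_frame_mx pi o1).
  rewrite det_mulmx dE mul1r det1; apply: contra_eq_neq => ->.
  by rewrite mul0r eq_sym oner_neq0.
have [dpos|dneg] := ltP 0 (\det (frame_mx i b1)).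
  exists (1 *: w1) => /=; split=> //; apply/(positively_orientedE _ pi).
  by rewrite dE mul1r.
exists (-1 *: w1) => /=; split; first by apply: on; rewrite mulrNN mulr1.
apply/(positively_orientedE _ pi); rewrite dE mulN1r oppr_gt0 lt_neqAle d1.
by rewrite dneg.
Qed.

End Frames.

(** * Regularity of inner products and of completed frames *)

Section CkFields.
Context {R : realType} {n : nat} {M : oriented_riemannian R n}.
Context (tau : R) (htau : 0 < tau).
Implicit Types (i j : chart M) (x : R -> M) (t : R).

Lemma Ck_fieldD k x (Y Z : forall t, tangent (x t)) :
  Ck_field tau k Y -> Ck_field tau k Z -> Ck_field tau k (fun t => Y t + Z t).
Proof. by move=> Yk Zk i; exact: Ck_inD (Yk i) (Zk i). Qed.

Lemma Ck_fieldZ k x c (Z : forall t, tangent (x t)) :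
  Ck_scalar tau k x c -> Ck_field tau k Z -> Ck_field tau k (fun t => c t *: Z t).
Proof. by move=> ck Zk i; exact: Ck_inZ (ck i) (Zk i). Qed.

Lemma Ck_inner k x (Y Z : forall t, tangent (x t)) : Ck_curve tau k x ->
  Ck_field tau k Y -> Ck_field tau k Z ->
  Ck_scalar tau k x (fun t => inner (Y t) (Z t)).
Proof.
move=> xC Yk Zk i; have gk := Ck_metric i xC.
have /Ck_in_mxP/(_ 0 0) := Ck_in_mulmx (Ck_in_mulmx (Yk i) gk) (Ck_in_trmx (Zk i)).
by apply: Ck_in_eq => t [_ xi] /=; rewrite (innerE _ _ xi).
Qed.

(** The hypothesis supplies one derivative for each chart; by uniqueness they are restrictions of a
    single function on the interval. *)
Lemma Ck_scalar_deriv k x c : continuous_curve tau x ->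
  Ck_scalar tau k.+1 x c -> exists2 c', Ck_scalar tau k x c' &
    forall t, t \in `[0, tau] -> is_deriv_in `[0, tau] c t (c' t).
Proof.
move=> xc ck; pose c' t := xget 0 [set l | is_deriv_in `[0, tau] c t l].
have c'P t : t \in `[0, tau] -> is_deriv_in `[0, tau] c t (c' t).
  move=> tI; have xi := chart_atP (x t); have [f' ff' _] := ck (chart_at (x t)).
  have := ff' t (conj tI xi); rewrite deriv_chart_times// => fd.
  by rewrite /c'; case: xgetP => [l _ //|/(_ _ fd)].
exists c' => // i; have [f' ff' f'k] := ck i.
apply: Ck_in_eq f'k => t ti; have [tI xi] := ti.
apply: deriv_in_unique (proper_itv htau tI) _ (c'P t tI).
by rewrite -(deriv_chart_times _ _ xc ti); exact: ff'.
Qed.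

(** The formula of [frame_last] is algebraic in the metric and the other fields up to a square root
    of a positive function, so no derivative is lost. *)
Lemma Ck_last_field k x (b : 'I_n -> forall t, tangent (x t)) (l : 'I_n) :
  Ck_curve tau k x ->
  (forall t, t \in `[0, tau] -> orthonormal_family (b ^~ t) /\ positively_oriented (b ^~ t)) ->
  (forall a, a != l -> Ck_field tau k (b a)) -> Ck_field tau k (b l).
Proof.
move=> xC bop bk i; have gk := Ck_metric i xC.
have gu t : chart_times tau x i t -> (@metric _ _ M i \o (chart_map i \o x)) t \in unitmx.
  by move=> [_ xi]; exact: metric_unit.
have ginv := Ck_in_invmx gu gk.
(* The row [l], whose regularity is sought, is blanked; the cofactors along it do not see it. *)
pose F t : 'M[R]_n := \matrix_(a < n) (if a == l then 0 else b a t i).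
have Fk : Ck_in k (chart_times tau x i) F.
  apply/Ck_in_mxP => a c; case: (eqVneq a l) => al.
    by apply: Ck_in_eq (Ck_in_cst k _ (0 : R)) => t _; rewrite mxE al eqxx mxE.
  have /Ck_in_mxP/(_ 0 c) := bk a al i.
  by apply: Ck_in_eq => t _; rewrite [RHS]mxE (negbTE al).
apply: (@Ck_in_eq _ _ _ _ (fun t => Num.sqrt (\det (metric i (chart_map i (x t)))) *:
    (\row_a cofactor (F t) l a *m invmx (metric i (chart_map i (x t)))))).
  move=> t [tI xi]; have [ob pb] := bop t tI.
  rewrite [RHS](frame_last l xi ob pb); congr (_ *: (_ *m _)).
  apply/rowP => a; rewrite !mxE; apply: cofactor_row_eq => c cl.
  by rewrite !rowK (negbTE cl).
apply: Ck_inZ; last apply: Ck_in_mulmx ginv.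
  apply: Ck_in_sqrt; last exact: Ck_in_det.
  move=> t [tI xi] /=; have [ob pb] := bop t tI.
  by rewrite -sqrtr_gt0 (sqrt_det_metric xi ob pb) invr_gt0; apply/positively_orientedE.
apply/Ck_in_mxP => z a; apply: Ck_in_eq (Ck_in_cofactor l a Fk) => t _.
by rewrite mxE.
Qed.

End CkFields.

(** * Invariance under change of the curve outside the interval *)

Section Congruence.
Context {R : realType} {n : nat} {M : oriented_riemannian R n}.
Context (tau : R).
Implicit Types (p : M) (i : chart M) (x y : R -> M) (t : R).

(** Once the points are identified the two sets are equal, and the choice, default included, depends
    on the set alone. *)
Lemma xget_tangent_congr p p' (A : set (tangent p)) (B : set (tangent p')) :
  p = p' -> (forall v w, tangent_val v = tangent_val w -> (A v <-> B w)) ->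
  tangent_val (xget 0 A) = tangent_val (xget 0 B).
Proof.
move=> pp'; case: p' / pp' B => B AB; congr (tangent_val (xget _ _)).
by apply/seteqP; split=> v; rewrite (AB v v).
Qed.

Lemma inner_congr p p' (v w : tangent p) (v' w' : tangent p') : p = p' ->
  tangent_val v = tangent_val v' -> tangent_val w = tangent_val w' ->
  inner v w = inner v' w'.
Proof. by move=> pp'; case: p' / pp' v' w' => v' w' /val_inj -> /val_inj ->. Qed.

Lemma frame_congr p p' (b : 'I_n -> tangent p) (b' : 'I_n -> tangent p') : p = p' ->
  (forall k, tangent_val (b k) = tangent_val (b' k)) ->
  (orthonormal_family b /\ positively_oriented b <->
   orthonormal_family b' /\ positively_oriented b').
Proof.
move=> pp'; case: p' / pp' b' => b' bb'.
by have -> : b = b' by apply/funext => k; exact/val_inj/bb'.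
Qed.

(* [tangent (x t)] and [tangent (y t)] are different types even when
   [x t = y t]; vectors are therefore compared through their coordinates. *)
Definition field_congr x y (Z : forall t, tangent (x t)) (W : forall t, tangent (y t)) :=
  forall t, t \in `[0, tau] -> tangent_val (Z t) = tangent_val (W t).

Lemma field_congr_sym x y (Z : forall t, tangent (x t)) (W : forall t, tangent (y t)) :
  field_congr Z W -> field_congr W Z.
Proof. by move=> ZW t tI; rewrite ZW. Qed.

Definition curve_congr x y := forall t, t \in `[0, tau] -> x t = y t.

Lemma curve_congr_sym x y : curve_congr x y -> curve_congr y x.
Proof. by move=> xy t tI; rewrite xy. Qed.

Lemma is_velocity_congr x y t (v : tangent (x t)) (w : tangent (y t)) :
  curve_congr x y -> t \in `[0, tau] -> tangent_val v = tangent_val w ->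
  is_velocity tau v -> is_velocity tau w.
Proof.
move=> xy tI vw vP i yi; have xi : chart_dom i (x t) by rewrite xy.
have := vP i xi; rewrite vw; apply: deriv_in_eq => // s sI.
by rewrite /= xy.
Qed.

Lemma velocity_congr x y : curve_congr x y ->
  field_congr (velocity tau x) (velocity tau y).
Proof.
move=> xy t tI; apply: xget_tangent_congr (xy t tI) _ => v w vw /=; split.
  exact: is_velocity_congr.
by apply: is_velocity_congr; [exact: curve_congr_sym| |].
Qed.

Lemma is_covariant_congr x y (Z : forall t, tangent (x t)) (W : forall t, tangent (y t))
    t (v : tangent (x t)) (w : tangent (y t)) :
  curve_congr x y -> field_congr Z W -> t \in `[0, tau] ->
  tangent_val v = tangent_val w -> is_covariant tau Z v -> is_covariant tau W w.
Proof.
move=> xy ZW tI vw vP i yi; have xi : chart_dom i (x t) by rewrite xy.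
have [dz dzP wE] := vP i xi; exists dz.
  by apply: deriv_in_eq dzP => // s sI; rewrite ZW.
by rewrite -vw wE (velocity_congr xy tI) (ZW t tI) (xy t tI).
Qed.

Lemma covariant_congr x y (Z : forall t, tangent (x t)) (W : forall t, tangent (y t)) :
  curve_congr x y -> field_congr Z W ->
  field_congr (covariant tau Z) (covariant tau W).
Proof.
move=> xy ZW t tI; apply: xget_tangent_congr (xy t tI) _ => v w vw /=; split.
  exact: is_covariant_congr.
apply: is_covariant_congr => //; first exact: curve_congr_sym.
exact: field_congr_sym.
Qed.

Section TwoCurves.
Context (x y : R -> M) (xy : curve_congr x y).

Lemma Ck_field_congr k (Z : forall t, tangent (x t)) (W : forall t, tangent (y t)) :
  field_congr Z W -> Ck_field tau k Z -> Ck_field tau k W.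
Proof.
move=> ZW Zk i.
have <- : chart_times tau x i = chart_times tau y i.
  by apply/seteqP; split=> t [tI] /= ti; split=> //=; move: ti; rewrite xy.
by apply: Ck_in_eq (Zk i) => t [tI _]; rewrite ZW.
Qed.

Lemma iter_covariant_congr l (Z : forall t, tangent (x t)) (W : forall t, tangent (y t)) :
  field_congr Z W ->
  field_congr (iter l (@covariant _ _ _ tau x) Z) (iter l (@covariant _ _ _ tau y) W).
Proof. by move=> ZW; elim: l => [//|l IHl] /=; exact: covariant_congr. Qed.

Lemma Ck_curve_congr k : Ck_curve tau k x -> Ck_curve tau k y.
Proof.
move=> [xc xk]; split.
  apply/subspace_continuousP => t tI.
  change (y @ within `[0, tau] (nbhs t) --> y t).
  rewrite -xy//; move/subspace_continuousP : xc => /(_ t tI) H.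
  apply: (cvg_trans _ H); apply: near_eq_cvg; rewrite near_withinE.
  by near=> s => sI; exact: xy.
move=> i.
have E : `[0, tau] `&` x @^-1` chart_dom i = `[0, tau] `&` y @^-1` chart_dom i.
  by apply/seteqP; split=> t [tI] /=; rewrite xy.
by rewrite -E; apply: Ck_in_eq (xk i) => t [tI _] /=; rewrite xy.
Unshelve. all: by end_near. Qed.

Lemma arclength_congr : arclength tau x -> arclength tau y.
Proof.
move=> xa t tI; rewrite -(xa t tI) /tnorm; congr Num.sqrt.
by apply/esym/inner_congr => //; [exact: xy|exact: velocity_congr|exact: velocity_congr].
Qed.

Lemma Ck_regular_congr k : Ck_regular tau k x -> Ck_regular tau k y.
Proof.
move=> xr t tI c c0; apply: (xr t tI c); apply/val_inj/funext => i /=.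
have := congr1 (fun v => tangent_val v i) c0; rewrite !tangent_sum => {}c0.
apply: (eq_trans _ c0); apply: eq_bigr => l _; rewrite !tangentZ.
by rewrite (iter_covariant_congr l (velocity_congr xy) tI).
Qed.

Lemma frenetS (z : R -> M) j : frenet tau z j.+1 =
  let u t := covariant tau (frenet tau z j).2 t +
             (frenet tau z j).1.1 t *: (frenet tau z j).1.2 t in
  (fun t => tnorm (u t), (frenet tau z j).2, fun t => (tnorm (u t))^-1 *: u t).
Proof. by rewrite /=; case: (frenet tau z j) => [[? ?] ?]. Qed.

Lemma frenet_congr j :
  [/\ forall t, t \in `[0, tau] -> (frenet tau x j).1.1 t = (frenet tau y j).1.1 t,
      field_congr (frenet tau x j).1.2 (frenet tau y j).1.2 &
      field_congr (frenet tau x j).2 (frenet tau y j).2].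
Proof.
elim: j => [|j [IH1 IH2 IH3]]; first by split=> //; exact: velocity_congr.
rewrite !frenetS /=.
pose u t := covariant tau (frenet tau x j).2 t +
  (frenet tau x j).1.1 t *: (frenet tau x j).1.2 t.
pose u' t := covariant tau (frenet tau y j).2 t +
  (frenet tau y j).1.1 t *: (frenet tau y j).1.2 t.
have uu' : field_congr u u'.
  move=> t tI; apply/funext => i; rewrite /u /u' !tangentD !tangentZ.
  by rewrite IH1// (covariant_congr xy IH3 tI) (IH2 t tI).
have nn' t : t \in `[0, tau] -> tnorm (u t) = tnorm (u' t).
  by move=> tI; rewrite /tnorm (inner_congr (xy tI) (uu' t tI) (uu' t tI)).
split=> // t tI; apply/funext => i.
by rewrite !tangentZ -/(u t) -/(u' t) (nn' t tI) (uu' t tI).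
Qed.

Lemma frenet_basis_congr t (v : tangent (x t)) (w : tangent (y t)) k :
  t \in `[0, tau] -> tangent_val v = tangent_val w ->
  tangent_val (frenet_basis tau v k) = tangent_val (frenet_basis tau w k).
Proof.
move=> tI vw; rewrite /frenet_basis; case: ifP => // _.
by have [_ _ ->] := frenet_congr k.
Qed.

Lemma frenet_last_congr : field_congr (frenet_last tau x) (frenet_last tau y).
Proof.
move=> t tI; apply: xget_tangent_congr (xy tI) _ => v w vw /=.
by apply: frame_congr (xy tI) _ => k; exact: frenet_basis_congr.
Qed.

Lemma geodesic_curvature_congr j t : t \in `[0, tau] ->
  geodesic_curvature tau x j t = geodesic_curvature tau y j t.
Proof.
move=> tI; rewrite /geodesic_curvature; case: ifP => _.
  by have [->] := frenet_congr j.
have [IH1 IH2 IH3] := frenet_congr n.-2.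
move: IH1 IH2 IH3; case: (frenet tau x n.-2) => [[k v] w].
case: (frenet tau y n.-2) => [[k' v'] w'] /= kk vv ww.
apply: inner_congr (xy tI) (frenet_last_congr tI) _.
by apply/funext => i; rewrite !tangentD !tangentZ kk// vv// (covariant_congr xy ww tI).
Qed.

End TwoCurves.
End Congruence.

(** * The Frenet frame of a curve *)

Section FrenetFrame.
Context {R : realType} {n : nat} {M : oriented_riemannian R n}.
Context (hn : (2 <= n)%N) (tau : R) (htau : 0 < tau) (x : R -> M).
Context (xC : Ck_curve tau n x) (xa : arclength tau x) (xr : Ck_regular tau n.-1 x).
Implicit Types (t : R).

Let xc : continuous_curve tau x := xC.1.
Let D l := iter l (@covariant _ _ _ tau x) (velocity tau x).

Lemma Ck_iter_covariant l k : (l + k < n)%N -> Ck_field tau k (D l).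
Proof.
elim: l k => [|l IHl] k lk.
  by apply: Ck_velocity => //; apply: Ck_curveW xC.
apply: Ck_covariant => //; first apply: Ck_curveW xC.
    by rewrite (leq_trans _ lk)// ltnS leq_addl.
by apply: IHl; rewrite addnS -addSn.
Qed.

(** The coefficients are indexed by [nat], so that the number [j] of terms can grow without changing
    their type. *)
Definition covariant_span k j (Z : forall t, tangent (x t)) := exists2 c : nat -> R -> R,
  forall l, Ck_scalar tau k x (c l) &
  forall t, t \in `[0, tau] -> Z t = \sum_(l < j) c l t *: D l t.

Lemma covariant_spanD k j Y Z : covariant_span k j Y -> covariant_span k j Z ->
  covariant_span k j (fun t => Y t + Z t).
Proof.
move=> [c ck Yc] [d dk Zd]; exists (fun l t => c l t + d l t).
  by move=> l i; exact: Ck_inD (ck l i) (dk l i).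
by move=> t tI; rewrite Yc// Zd// -big_split; apply: eq_bigr => l _; rewrite scalerDl.
Qed.

Lemma covariant_spanZ k j a Z : Ck_scalar tau k x a -> covariant_span k j Z ->
  covariant_span k j (fun t => a t *: Z t).
Proof.
move=> ak [d dk Zd]; exists (fun l t => a t * d l t).
  by move=> l i; exact: Ck_inM (ak i) (dk l i).
by move=> t tI; rewrite Zd// scaler_sumr; apply: eq_bigr => l _; rewrite scalerA.
Qed.

Lemma covariant_spanW k m j Z : (m <= k)%N -> covariant_span k j Z -> covariant_span m j Z.
Proof. by move=> mk [c ck Zc]; exists c => // l i; exact: Ck_in_le mk (ck l i). Qed.

Lemma covariant_spanS k j Z : covariant_span k j Z -> covariant_span k j.+1 Z.
Proof.
move=> [c ck Zc]; exists (fun l => if (l < j)%N then c l else fun=> 0).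
  by move=> l i; case: ifP => _; [exact: ck|exact: Ck_in_cst].
move=> t tI; rewrite big_ord_recr/= ltnn scale0r addr0 Zc//.
by apply: eq_bigr => l _; rewrite ltn_ord.
Qed.

Lemma covariant_span_term k j a : Ck_scalar tau k x a ->
  covariant_span k j.+1 (fun t => a t *: D j t).
Proof.
move=> ak; exists (fun l => if l == j then a else fun=> 0).
  by move=> l i; case: ifP => _; [exact: ak|exact: Ck_in_cst].
move=> t tI; rewrite big_ord_recr/= eqxx big1 ?add0r// => l _.
by rewrite ltn_eqF ?ltn_ord// scale0r.
Qed.

Lemma covariant_span_eq k j Y Z : (forall t, t \in `[0, tau] -> Y t = Z t) ->
  covariant_span k j Y -> covariant_span k j Z.
Proof. by move=> YZ [c ck Yc]; exists c => // t tI; rewrite -YZ// Yc. Qed.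

Lemma covariant_iter l t : (l.+1 < n)%N -> t \in `[0, tau] ->
  is_covariant tau (D l) (D l.+1 t).
Proof.
move=> ln tI; apply: covariantP => //.
  by apply: (@velocityP _ _ _ _ htau 0) => //; apply: Ck_curveW xC; exact: leq_trans hn.
by apply: Ck_iter_covariant; rewrite addn1.
Qed.

(** In the product rule only the differentiated vectors raise the order, so the leading coefficient
    [c] is passed on unchanged, at the cost of one derivative of the coefficients. *)
Lemma covariant_span_deriv k j Y c Z : (j.+1 < n)%N ->
  covariant_span k.+1 j Y -> Ck_scalar tau k.+1 x c ->
  (forall t, t \in `[0, tau] -> Z t = Y t + c t *: D j t) ->
  exists2 Y', covariant_span k j.+1 Y' &
    forall t, t \in `[0, tau] -> covariant tau Z t = Y' t + c t *: D j.+1 t.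
Proof.
move=> jn [d dk Yd] ck ZE.
have /choice[d' d'P] : forall l, exists d', Ck_scalar tau k x d' /\
    forall t, t \in `[0, tau] -> is_deriv_in `[0, tau] (d l) t (d' t).
  by move=> l; have [d' d'k d'd] := Ck_scalar_deriv htau xc (dk l); exists d'.
have [c' c'k c'P] := Ck_scalar_deriv htau xc ck.
(* The coefficients [d] moved up by one place, since [D l] becomes [D l.+1]. *)
pose sd l t := if l is l'.+1 then d l' t else 0.
exists (fun t => (\sum_(l < j) d' l t *: D l t + c' t *: D j t) +
    \sum_(l < j.+1) sd l t *: D l t).
  apply: covariant_spanD; last first.
    exists sd => // -[|l] i; first exact: Ck_in_cst.
    exact: Ck_in_le (leqnSn k) (dk l i).
  apply: covariant_spanD; last exact: covariant_span_term.
  by apply: covariant_spanS; exists d' => // l; exact: (d'P l).1.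
move=> t tI; apply: (covariantE htau tI).
have H : is_covariant tau (fun s => \sum_(l < j) d l s *: D l s + c s *: D j s)
    (\sum_(l < j) (d' l t *: D l t + d l t *: D l.+1 t) + (c' t *: D j t + c t *: D j.+1 t)).
  apply: is_covariantD.
    apply: is_covariant_sum => l; apply: is_covariantZ; first exact: (d'P l).2.
    by apply: covariant_iter => //; rewrite (leq_trans _ jn)// !ltnS ltnW.
  by apply: is_covariantZ; [exact: c'P|exact: covariant_iter].
apply: (is_covariant_congr _ _ tI _ H) => //; first by move=> s sI; rewrite ZE// Yd.
rewrite big_split/= addrA big_ord_recl/= scale0r add0r.
congr (_ + _); rewrite addrAC; congr (_ + _).
Qed.

Let e j := (frenet tau x j).2.
Let kappa j := (frenet tau x j).1.1.
Let prev j := (frenet tau x j).1.2.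
Let u j t := covariant tau (e j) t + kappa j t *: prev j t.

Let frenetE j : [/\ kappa j.+1 = (fun t => tnorm (u j t)), prev j.+1 = e j &
  e j.+1 = fun t => (tnorm (u j t))^-1 *: u j t].
Proof. by rewrite /kappa /prev /e frenetS. Qed.

(* [e_j] is a combination of the first [j + 1] covariant derivatives of the
   velocity with nonvanishing leading coefficient, hence so is [u_j] one step
   further, and regularity forces [u_j != 0]. *)
Lemma frenet_invariant j k : (j + k).+1 = n -> (0 < k)%N ->
  [/\ Ck_field tau k (e j), Ck_scalar tau k x (kappa j), Ck_field tau k (prev j),
      covariant_span k j (prev j) &
      exists2 Y, covariant_span k j Y & exists c,
      [/\ Ck_scalar tau k x c, forall t, t \in `[0, tau] -> c t != 0 &
          forall t, t \in `[0, tau] -> e j t = Y t + c t *: D j t]] /\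
  forall t, t \in `[0, tau] -> (0 < j)%N -> kappa j t != 0.
Proof.
(* [k] counts the derivatives still available. Each Frenet step spends one, so it varies in the
   induction. *)
elim: j k => [|j IHj] k jk k0.
  split=> //; split.
  - by apply: Ck_velocity => //; apply: Ck_curveW xC; rewrite -jk.
  - by move=> i; exact: Ck_in_cst.
  - by move=> i; exact: Ck_in_cst.
  - exists (fun _ _ => 0); first by move=> l i; exact: Ck_in_cst.
    by move=> t tI; rewrite big_ord0.
  - exists (fun=> 0).
      exists (fun _ _ => 0); first by move=> l i; exact: Ck_in_cst.
      by move=> t tI; rewrite big_ord0.
    exists (fun=> 1); split; first by move=> i; exact: Ck_in_cst.
      by move=> t _; exact: oner_neq0.
    by move=> t tI; rewrite scale1r add0r.
have [|//|[ek kk pk ps [Y Ys [c [ck c0 eE]]]] _] := IHj k.+1; first by rewrite addnS -addSn.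
have jn : (j.+1.+1 <= n)%N by rewrite -jk ltnS leq_addr.
have kn : (k.+1 <= n)%N by rewrite -jk ltnS leq_addl.
have xk : Ck_curve tau k x by apply: Ck_curveW xC; exact: ltnW.
have [Y' Y's covE] := covariant_span_deriv jn Ys ck eE.
have kkW : Ck_scalar tau k x (kappa j) by move=> i; exact: Ck_in_le (leqnSn k) (kk i).
have ckW : Ck_scalar tau k x c by move=> i; exact: Ck_in_le (leqnSn k) (ck i).
have uk : Ck_field tau k (u j).
  apply: Ck_fieldD; first by apply: Ck_covariant => //; apply: Ck_curveW xC.
  by apply: Ck_fieldZ => //; exact: Ck_fieldW (leqnSn k) pk.
have uE t : t \in `[0, tau] -> u j t = (Y' t + kappa j t *: prev j t) + c t *: D j.+1 t.
  by move=> tI; rewrite /u covE// addrAC.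
have us : covariant_span k j.+1 (fun t => Y' t + kappa j t *: prev j t).
  apply: covariant_spanD => //; apply: covariant_spanZ => //.
  by apply: covariant_spanS; exact: covariant_spanW (leqnSn k) ps.
have u0 t : t \in `[0, tau] -> u j t != 0.
  move=> tI; apply/eqP; rewrite uE//; have [d _ ->//] := us.
  move=> s0; have jn1 : (j.+1 < n.-1)%N by rewrite -jk/= -{1}[j.+1]addn0 ltn_add2l.
  (* Padded by zeros, the relation [u j t = 0] becomes one between all [n - 1] vectors of the
     regularity condition, with the nonzero coefficient [c t] at place [j.+1]. *)
  pose a (l : 'I_n.-1) := if (l < j.+1)%N then d l t else if l == j.+1 :> nat then c t else 0.
  have /(_ a) H := xr tI.
  have {H} : a (Ordinal jn1) = 0.
    apply: H; apply: (eq_trans _ s0).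
    rewrite -(big_mkord xpredT (fun l => (if (l < j.+1)%N then d l t else
      if l == j.+1 :> nat then c t else 0) *: D l t)).
    rewrite (big_cat_nat (n := j.+2))//= (big_nat_recr j.+1)//= ltnn eqxx.
    rewrite [X in _ + X]big1_seq ?addr0.
      by rewrite big_mkord; congr (_ + _); apply: eq_bigr => l _; rewrite ltn_ord.
    move=> l; rewrite mem_index_iota => /andP[_ /andP[jl _]].
    by rewrite ltnNge (ltnW jl)/= gtn_eqF// scale0r.
  by rewrite /a/= ltnn eqxx => /eqP; rewrite (negbTE (c0 t tI)).
have nk : Ck_scalar tau k x (fun t => tnorm (u j t)).
  move=> i; apply: Ck_in_sqrt; last exact: Ck_inner.
  by move=> t [tI _]; rewrite inner_gt0// u0.
have nVk : Ck_scalar tau k x (fun t => (tnorm (u j t))^-1).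
  by move=> i; apply: Ck_inV => // t [tI _]; rewrite gt_eqF// tnorm_gt0// u0.
have [-> -> ->] := frenetE j; split; last first.
  by move=> t tI _; rewrite gt_eqF// tnorm_gt0// u0.
split=> //.
- exact: Ck_fieldZ.
- exact: Ck_fieldW (leqnSn k) ek.
- apply: (@covariant_span_eq _ _ (fun t => Y t + c t *: D j t)).
    by move=> t tI; rewrite eE.
  apply: covariant_spanD; last exact: covariant_span_term.
  by apply: covariant_spanS; exact: covariant_spanW (leqnSn k) Ys.
exists (fun t => (tnorm (u j t))^-1 *: (Y' t + kappa j t *: prev j t)).
  exact: covariant_spanZ.
exists (fun t => (tnorm (u j t))^-1 * c t); split.
- by move=> i; exact: Ck_inM.
- by move=> t tI; rewrite mulf_neq0 ?c0// invr_neq0// gt_eqF// tnorm_gt0// u0.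
- by move=> t tI; rewrite uE// scalerDr scalerA.
Qed.

Let prevE b : prev b = if b is b'.+1 then e b' else fun=> 0.
Proof. by case: b => [//|b]; have [_ ->] := frenetE b. Qed.

Let velP t : t \in `[0, tau] -> is_velocity tau (velocity tau x t).
Proof.
by move=> tI; apply: (@velocityP _ _ _ _ htau 0) => //; apply: Ck_curveW xC; exact: leq_trans hn.
Qed.

Let covP (Z : forall t, tangent (x t)) t : Ck_field tau 1 Z -> t \in `[0, tau] ->
  is_covariant tau Z (covariant tau Z t).
Proof. by move=> Z1 tI; apply: covariantP => //; exact: velP. Qed.

Lemma Ck_frenet j : (j.+1 < n)%N -> Ck_field tau 1 (e j).
Proof.
move=> jn; have [||[ek _ _ _ _] _] := @frenet_invariant j (n.-1 - j).
- by rewrite subnKC; lia.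
- by lia.
by apply: Ck_fieldW ek; lia.
Qed.

Lemma inner_cst_deriv (Y Z : forall t, tangent (x t)) (c : R) t :
  Ck_field tau 1 Y -> Ck_field tau 1 Z -> t \in `[0, tau] ->
  (forall s, s \in `[0, tau] -> inner (Y s) (Z s) = c) ->
  inner (covariant tau Y t) (Z t) = - inner (covariant tau Z t) (Y t).
Proof.
move=> Y1 Z1 tI YZ; apply/eqP; rewrite -addr_eq0 [inner (covariant tau Z t) _]innerC.
have H1 := is_deriv_inner xc tI (velP tI) (covP Y1 tI) (covP Z1 tI).
have H2 : is_deriv_in `[0, tau] (fun s => inner (Y s) (Z s)) t 0.
  by apply: (deriv_in_eq _ tI (deriv_in_cst _ c t)) => s sI; rewrite YZ.
exact/eqP/(deriv_in_unique (proper_itv htau tI) H1 H2).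
Qed.

Lemma frenet_eq b t : (b.+2 < n)%N -> t \in `[0, tau] ->
  covariant tau (e b) t = kappa b.+1 t *: e b.+1 t - kappa b t *: prev b t.
Proof.
move=> bn tI; have [||_ k0] := @frenet_invariant b.+1 (n.-1 - b.+1); [lia|lia|].
have := k0 t tI isT; have [-> _ ->] := frenetE b => u0.
by rewrite scalerA divff// scale1r /u addrK.
Qed.

(** It suffices that [u j] is orthogonal to each [e c] with [c <= j]. Differentiating the constant
    inner product moves the derivative to [e c]. For [c < j] the Frenet equation then leaves a
    component along [e j] only if [c] is [j - 1], and the added multiple of [prev j] cancels it; for
    [c = j] skew symmetry gives 0. *)
Lemma frenet_orthonormal j : (j.+1 < n)%N -> forall a b, (a <= j)%N -> (b <= j)%N ->
  forall t, t \in `[0, tau] -> inner (e a t) (e b t) = (a == b)%:R.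
Proof.
elim: j => [|j IHj] jn a b aj bj t tI.
  move: aj bj; rewrite !leqn0 => /eqP -> /eqP ->; rewrite eqxx -tnorm_sqr.
  by rewrite /e/= xa// mulr1.
have {}IHj := IHj (ltnW jn).
have [||_ k0] := @frenet_invariant j.+1 (n.-1 - j.+1); [lia|lia|].
have {}k0 := k0 t tI isT; have [kE _ eE] := frenetE j; rewrite kE in k0.
have ub c : (c <= j)%N -> inner (u j t) (e c t) = 0.
  move=> cj; rewrite /u innerDl innerZl.
  rewrite (@inner_cst_deriv _ (e c) (j == c)%:R)//; last first.
  - by move=> s sI; rewrite IHj.
  - by apply: Ck_frenet; lia.
  - by apply: Ck_frenet; lia.
  move: cj; rewrite leq_eqVlt => /predU1P[->|cj].
    have /eqP : inner (covariant tau (e j) t) (e j t) = 0.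
      have e1 := Ck_frenet (ltnW jn).
      have := @inner_cst_deriv (e j) (e j) (j == j)%:R t e1 e1 tI.
      move=> /(_ (fun s sI => IHj j j (leqnn j) (leqnn j) s sI)) /eqP.
      by rewrite -addr_eq0 -mulr2n mulrn_eq0/= => /eqP.
    move=> /eqP ->; rewrite oppr0 add0r prevE.
    case: (j) IHj => [|j'] IHj; first by rewrite inner0l mulr0.
    by rewrite IHj// ltn_eqF// mulr0.
  have cn : (c.+2 < n)%N by lia.
  rewrite frenet_eq//.
  rewrite innerDl -scaleNr !innerZl IHj//.
  have -> : inner (prev c t) (e j t) = 0.
    rewrite prevE; case: (c) cj => [|c'] cj; first by rewrite inner0l.
    by rewrite IHj ?ltn_eqF//; lia.
  rewrite mulr0 addr0 prevE; case: (j) IHj cj => [//|j'] IHj cj.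
  rewrite IHj//; last by rewrite ltnW.
  rewrite eqSS eq_sym; case: eqP => [->|_]; first by rewrite !mulr1 addNr.
  by rewrite !mulr0 oppr0 addr0.
have eu c : (c <= j)%N -> inner (e j.+1 t) (e c t) = 0.
  by move=> cj; rewrite eE innerZl ub// mulr0.
have ee : inner (e j.+1 t) (e j.+1 t) = 1.
  by rewrite eE innerZl innerZr -tnorm_sqr; field.
have [aj'|->] : (a <= j)%N \/ a = j.+1 by lia.
  have [bj'|->] : (b <= j)%N \/ b = j.+1 by lia.
    exact: IHj.
  by rewrite innerC eu// ltn_eqF.
have [bj'|->] : (b <= j)%N \/ b = j.+1 by lia.
  by rewrite eu// gtn_eqF.
by rewrite ee eqxx.
Qed.

(** Counted from 0: [frenet_frame k] is v_(k+1), just as [e k] is for [k.+1 < n]. *)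
Definition frenet_frame (k : 'I_n) t : tangent (x t) :=
  frenet_basis tau (frenet_last tau x t) k.

Let last_lt : (n.-1 < n)%N. Proof. by case: (n) hn. Qed.
Let last : 'I_n := Ordinal last_lt.

Let ltn_last (k : 'I_n) : (k.+1 < n)%N = (k != last).
Proof.
rewrite -(inj_eq val_inj)/=; have := ltn_ord k; case: eqP => /= [->|]; lia.
Qed.

Lemma frenet_frameP t : t \in `[0, tau] ->
  orthonormal_family (frenet_frame ^~ t) /\ positively_oriented (frenet_frame ^~ t).
Proof.
move=> tI.
have [|w wP] := @orthonormal_last_exists _ _ _ (x t) (fun k => e k t) last.
  move=> k k'; rewrite -!ltn_last => kn kn'.
  by apply: (@frenet_orthonormal n.-2); lia.
apply: (@xgetPex _ 0 [set w | orthonormal_family (frenet_basis tau w) /\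
  positively_oriented (frenet_basis tau w)]).
exists w => /=; move: wP => /=.
have -> : (fun k : 'I_n => if k == last then w else e k t) = frenet_basis tau w.
  by apply/funext => k; rewrite /frenet_basis ltn_last; case: eqP.
by [].
Qed.

Lemma frenet_frameE (k : 'I_n) : (k.+1 < n)%N -> frenet_frame k = e k.
Proof.
move=> kn; apply/functional_extensionality_dep => t.
by rewrite /frenet_frame /frenet_basis kn.
Qed.

Lemma Ck_frenet_frame k : Ck_field tau 1 (frenet_frame k).
Proof.
have x1 : Ck_curve tau 1 x by apply: Ck_curveW xC; exact: ltnW.
have H a : a != last -> Ck_field tau 1 (frenet_frame a).
  by rewrite -ltn_last => an; rewrite frenet_frameE//; exact: Ck_frenet.
have [->|] := eqVneq k last; last exact: H.
exact: (Ck_last_field x1 frenet_frameP H).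
Qed.

(** The skew tridiagonal matrix of the Frenet equations. The row [k] belongs to v_(k+1), so its
    entries are kappa_(k+1) to the right of the diagonal and -kappa_k to the left. *)
Definition frenet_matrix (gc : nat -> R -> R) (k l : nat) t : R :=
  if l == k.+1 then gc l t else if k == l.+1 then - gc k t else 0.

(** The rows with [k.+2 < n] follow from [frenet_eq]. Both sides are skew, which leaves the block of
    the last two indices; its entry off the diagonal is the definition of the signed curvature. *)
Lemma frenet_frame_structure k l t : t \in `[0, tau] ->
  inner (covariant tau (frenet_frame k) t) (frenet_frame l t) =
  frenet_matrix (geodesic_curvature tau x) k l t.
Proof.
move=> tI; have [ob pb] := frenet_frameP tI.
have anti a b : inner (covariant tau (frenet_frame a) t) (frenet_frame b t) =
    - inner (covariant tau (frenet_frame b) t) (frenet_frame a t).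
  apply: (@inner_cst_deriv _ _ (a == b)%:R) => //.
  - exact: Ck_frenet_frame.
  - exact: Ck_frenet_frame.
  - by move=> s sI; have [+ _] := frenet_frameP sI; apply.
have mat a b : frenet_matrix (geodesic_curvature tau x) a b t =
    - frenet_matrix (geodesic_curvature tau x) b a t.
  rewrite /frenet_matrix; case: eqP => [->|_].
    by rewrite ltn_eqF ?opprK// ltnS leqnSn.
  by case: eqP => // _; rewrite oppr0.
have gcE j : (j.+1 < n)%N -> geodesic_curvature tau x j t = kappa j t.
  by rewrite /geodesic_curvature => ->.
have prevI (a b : 'I_n) : (a.+1 < n)%N ->
    inner (prev a t) (frenet_frame b t) = (a == b.+1 :> nat)%:R.
  rewrite prevE; case: a => [[|a] /= an] an'; first by rewrite inner0l.
  have an2 : (a < n)%N by exact: ltnW.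
  have -> : e a = frenet_frame (Ordinal an2) by rewrite frenet_frameE.
  by rewrite (ob (Ordinal an2) b) eqSS.
have low (a b : 'I_n) : (a.+2 < n)%N ->
    inner (covariant tau (frenet_frame a) t) (frenet_frame b t) =
    frenet_matrix (geodesic_curvature tau x) a b t.
  move=> an; rewrite frenet_frameE ?frenet_eq//; last exact: ltnW.
  rewrite innerDl -scaleNr !innerZl prevI; last exact: ltnW.
  have an1 : (a.+1 < n)%N by exact: ltnW.
  have -> : e a.+1 = frenet_frame (Ordinal an1) by rewrite frenet_frameE.
  rewrite (ob (Ordinal an1) b) -(inj_eq val_inj)/=.
  rewrite /frenet_matrix eq_sym; case: eqP => [bE|_].
    by rewrite mulr1 bE ltn_eqF ?mulr0 ?addr0 ?gcE// ltnS leqnSn.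
  by case: eqP => _; rewrite !(mulr0, mulr1) ?add0r ?gcE.
have [kn|kn] := ltnP k.+2 n; first exact: low.
have [ln|ln] := ltnP l.+2 n; first by rewrite anti mat low.
have diag a : inner (covariant tau (frenet_frame a) t) (frenet_frame a t) = 0.
  by have /eqP := anti a a; rewrite -addr_eq0 -mulr2n mulrn_eq0/= => /eqP.
have top (a b : 'I_n) : a.+2 = n -> b.+1 = n ->
    inner (covariant tau (frenet_frame a) t) (frenet_frame b t) =
    frenet_matrix (geodesic_curvature tau x) a b t.
  move=> an bn; have an1 : (a.+1 < n)%N by rewrite an.
  have ba : (b == a.+1 :> nat) by apply/eqP; lia.
  rewrite /frenet_matrix ba.
  rewrite /geodesic_curvature bn ltnn.
  have -> : n.-2 = a by lia.
  have := prevI a b an1; rewrite /prev.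
  rewrite (frenet_frameE an1) /e; case: (frenet tau x a) => [[k' v'] w'] /= pI.
  have -> : frenet_last tau x t = frenet_frame b t.
    by rewrite /frenet_frame /frenet_basis bn ltnn.
  rewrite innerDr innerZr [inner _ (v' t)]innerC pI [inner _ (covariant _ _ _)]innerC.
  by rewrite ltn_eqF ?mulr0 ?addr0//; lia.
have := ltn_ord k; have := ltn_ord l => ln' kn'.
have [kl|kl] := eqVneq (k : nat) l.
  have -> : k = l by exact: val_inj.
  rewrite diag /frenet_matrix !ltn_eqF//.
have [kl'|kl'] := ltnP k l; first by apply: top; lia.
by rewrite anti mat top//; lia.
Qed.

Lemma frenet_frame_covariant k t : t \in `[0, tau] ->
  is_covariant tau (frenet_frame k)
    (\sum_(l < n) frenet_matrix (geodesic_curvature tau x) k l t *: frenet_frame l t).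
Proof.
move=> tI; have [ob _] := frenet_frameP tI.
have := covP (Ck_frenet_frame k) tI.
rewrite (orthonormal_expand (covariant _ _ _) ob).
by under eq_bigr do rewrite frenet_frame_structure//.
Qed.

End FrenetFrame.

(** * Rollings *)

Section FrameIsometry.
Context {R : realType} {n : nat} {M N : oriented_riemannian R n}.
Implicit Types (p : M) (r : N) (i : chart M) (j : chart N).

Definition frame_iso p r (b : 'I_n -> tangent p) (b' : 'I_n -> tangent r)
  (v : tangent p) : tangent r := \sum_k inner v (b k) *: b' k.

Lemma frame_iso_linear p r (b : 'I_n -> tangent p) (b' : 'I_n -> tangent r) :
  linear (frame_iso b b').
Proof.
move=> a v w; rewrite /frame_iso scaler_sumr -big_split/=; apply: eq_bigr => k _.
by rewrite innerDl innerZl scalerDl scalerA.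
Qed.

HB.instance Definition _ p r (b : 'I_n -> tangent p) (b' : 'I_n -> tangent r) :=
  GRing.isLinear.Build R (tangent p) (tangent r) *:%R (frame_iso b b')
    (frame_iso_linear b b').

(** The coordinate matrix of the isometry, whose absolute continuity a rolling requires; it inherits
    the regularity of the frames. *)
Lemma frame_iso_mx p r i j (b : 'I_n -> tangent p) (b' : 'I_n -> tangent r) v :
  chart_dom i p ->
  frame_iso b b' v j = v i *m (metric i (chart_map i p) *m (frame_mx i b)^T *m frame_mx j b').
Proof.
move=> pi; rewrite /frame_iso tangent_sum !mulmxA mulmx_sum_row.
apply: eq_bigr => k _; rewrite tangentZ rowK; congr (_ *: _).
rewrite (innerE _ _ pi) !mxE; apply: eq_bigr => a _; by rewrite !mxE.
Qed.

Lemma frame_iso_coord p r (b : 'I_n -> tangent p) (b' : 'I_n -> tangent r) v k :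
  orthonormal_family b' -> inner (frame_iso b b' v) (b' k) = inner v (b k).
Proof.
move=> ob'; rewrite inner_suml (bigD1 k)//= innerZl ob' eqxx mulr1 big1 ?addr0// => l lk.
by rewrite innerZl ob' (negbTE lk) mulr0.
Qed.

Lemma frame_iso_basis p r (b : 'I_n -> tangent p) (b' : 'I_n -> tangent r) k :
  orthonormal_family b -> frame_iso b b' (b k) = b' k.
Proof.
move=> ob; rewrite /frame_iso (bigD1 k)//= ob eqxx scale1r big1 ?addr0// => l lk.
by rewrite ob eq_sym (negbTE lk) scale0r.
Qed.

Lemma frame_iso_inner p r (b : 'I_n -> tangent p) (b' : 'I_n -> tangent r) v w :
  orthonormal_family b -> orthonormal_family b' ->
  inner (frame_iso b b' v) (frame_iso b b' w) = inner v w.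
Proof.
move=> ob ob'; rewrite {1}(orthonormal_expand v ob) linear_sum !inner_suml.
rewrite [in RHS](orthonormal_expand v ob) inner_suml.
apply: eq_bigr => k _; rewrite linearZ/= !innerZl; congr (_ * _).
by rewrite frame_iso_basis// innerC frame_iso_coord// innerC.
Qed.

Lemma frame_iso_oriented p r (b : 'I_n -> tangent p) (b' : 'I_n -> tangent r)
    (c : 'I_n -> tangent p) :
  orthonormal_family b -> positively_oriented b ->
  positively_oriented b' -> positively_oriented c ->
  positively_oriented (frame_iso b b' \o c).
Proof.
move=> ob pb pb' pc; have pi := chart_atP p; have pj := chart_atP r.
set i := chart_at p in pi; set j := chart_at r in pj.
apply/(positively_orientedE _ pj).
have -> : frame_mx j (frame_iso b b' \o c) = frame_mx i c *m
    (metric i (chart_map i p) *m (frame_mx i b)^T *m frame_mx j b').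
  by apply/row_matrixP => k; rewrite row_mul !rowK (frame_iso_mx _ _ _ _ pi).
rewrite 2!det_mulmx; apply: mulr_gt0; first exact/(positively_orientedE _ pi).
apply: mulr_gt0; last exact/(positively_orientedE _ pj).
have d0 : 0 < \det (frame_mx i b) by exact/(positively_orientedE _ pi).
have := congr1 determinant (orthonormal_frame_mx pi ob).
by rewrite !det_mulmx det1 => E; rewrite -(pmulr_rgt0 _ d0) E.
Qed.

Definition frame_configuration p r (b : 'I_n -> tangent p) (b' : 'I_n -> tangent r)
    (ob : orthonormal_family b /\ positively_oriented b)
    (ob' : orthonormal_family b' /\ positively_oriented b') : configuration M N :=
  @Configuration R n M N p r (frame_iso b b')
    (fun v w => frame_iso_inner v w ob.1 ob'.1)
    (fun c => frame_iso_oriented ob.1 ob.2 ob'.2 (c := c)).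

End FrameIsometry.

Section Rolling.
Context {R : realType} {n : nat} {M N : oriented_riemannian R n}.
Context (tau : R) (htau : 0 < tau).

Lemma ae_imply (P Q : R -> Prop) : (forall t, P t -> Q t) ->
  {ae lebesgue_measure, forall t, P t} -> {ae lebesgue_measure, forall t, Q t}.
Proof. by move=> PQ; apply: negligibleS => t nQ Pt; exact/nQ/PQ. Qed.

Lemma Ck_ac_field (P : oriented_riemannian R n) (y : R -> P) (Z : forall t, tangent (y t)) :
  Ck_field tau 1 Z -> ac_field tau Z.
Proof.
move=> Z1 i a b a0 bt yi; apply: C1_abs_continuous (Z1 i) => t tab.
split; last exact: yi.
by move: tab => /andP[at_ tb]; rewrite /= in_itv/= (le_trans a0 at_) (le_trans tb bt).
Qed.

Lemma Ck_ac_curve (P : oriented_riemannian R n) (y : R -> P) :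
  Ck_curve tau 1 y -> ac_curve tau y.
Proof.
move=> [yc y1]; split=> // i a b a0 bt yi; apply: C1_abs_continuous (y1 i) => t tab.
split; last exact: yi.
by move: tab => /andP[at_ tb]; rewrite /= in_itv/= (le_trans a0 at_) (le_trans tb bt).
Qed.

(** Differentiable coordinates in a differentiable frame are enough for [Z] to have a covariant
    derivative; this is what handles the arbitrary fields in the no-twist condition. *)
Lemma covariant_of_coords (P : oriented_riemannian R n) (z : R -> P)
    (c : 'I_n -> forall t, tangent (z t)) (Z : forall t, tangent (z t)) t
    (dc : 'I_n -> tangent (z t)) (f : 'I_n -> R) :
  (forall s, orthonormal_family (c ^~ s)) ->
  (forall k, is_covariant tau (c k) (dc k)) ->
  (forall k, is_deriv_in `[0, tau] (fun s => inner (Z s) (c k s)) t (f k)) ->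
  is_covariant tau Z (\sum_k (f k *: c k t + inner (Z t) (c k t) *: dc k)).
Proof.
move=> oc cD fk.
have E : Z = fun s => \sum_k inner (Z s) (c k s) *: c k s.
  by apply/functional_extensionality_dep => s; exact: orthonormal_expand.
rewrite [X in is_covariant _ X _]E; apply: is_covariant_sum => k.
exact: is_covariantZ (fk k) (cD k).
Qed.

(** * From a rolling to equal curvatures *)

Section Forward.
Context (q : R -> configuration M N).
Let y t := base1 (q t).
Let yh t := base2 (q t).

(** In charts the equation compares [Wh] with [W] times the matrix of [q]. That matrix is absolutely
    continuous, hence continuous, near each time, so [ae_eq0_within] applies on a small interval. *)
Lemma rolling_ae_eq (W : forall t, tangent (y t)) (Wh : forall t, tangent (yh t)) :
  ac_configuration_curve tau q -> Ck_field tau 0 W -> Ck_field tau 0 Wh ->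
  {ae lebesgue_measure, forall t : R, t \in `[0, tau] -> Wh t = iso_map (q t) (W t)} ->
  forall t, t \in `[0, tau] -> Wh t = iso_map (q t) (W t).
Proof.
move=> [[yc _] [yhc _] qac] W0 Wh0 Wae t tI.
have xi := chart_atP (y t); have xj := chart_atP (yh t).
set i := chart_at (y t) in xi; set j := chart_at (yh t) in xj.
have [d d0 dP] : exists2 d, 0 < d & forall s, s \in `[0, tau] -> `|s - t| < d ->
    chart_dom i (y s) /\ chart_dom j (yh s).
  have /nbhs_ballP[d /= d0 dP] : \forall s \near t,
      (`[0, tau]%classic s -> chart_dom i (y s)) /\ (`[0, tau]%classic s -> chart_dom j (yh s)).
    exact: filterI (near_chart yc tI xi) (near_chart yhc tI xj).
  exists d => // s sI std; have [|H1 H2] := dP s; first by rewrite /ball/= distrC.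
  by split; [exact: H1|exact: H2].
pose a := Num.max 0 (t - d / 2); pose b := Num.min tau (t + d / 2).
move: (tI); rewrite in_itv/= => /andP[t0 tt].
have d20 : 0 < d / 2 by rewrite divr_gt0.
have ab : a < b.
  by rewrite /a /b lt_min !gt_max htau !(le_lt_trans t0) ?ltrDl//
    ?(lt_le_trans _ tt) ?gtrDl ?oppr_lt0//=; lra.
have tab : t \in `[a, b].
  by rewrite in_itv/= ge_max le_min t0 tt/= gerDl lerDl oppr_le0 ltW.
have sub s : a <= s <= b -> s \in `[0, tau] /\ `|s - t| < d.
  rewrite /a /b ge_max le_min => /andP[/andP[s0 sd] /andP[st sd']].
  by rewrite in_itv/= s0 st; split=> //; rewrite ltr_norml; apply/andP; split; lra.
have subI : `[a, b] `<=` `[0, tau].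
  by move=> s /=; rewrite in_itv/= => /sub[].
have [||s /sub[sI sd]|A AP Aac] := qac i j a b.
- by rewrite /a le_max lexx.
- by rewrite /b ge_min lexx.
- exact: dP.
have Ac : Ck_in 0 `[a, b] A := abs_continuous_continuous Aac.
have subi : `[a, b] `<=` chart_times tau y i.
  by move=> s /=; rewrite in_itv/= => /sub[sI sd]; split=> //; exact: (dP s sI sd).1.
have subj : `[a, b] `<=` chart_times tau yh j.
  by move=> s /=; rewrite in_itv/= => /sub[sI sd]; split=> //; exact: (dP s sI sd).2.
have hc : Ck_in 0 `[a, b] (fun s => W s i *m A s + -1 *: Wh s j).
  apply: Ck_inD; first by apply: Ck_in_mulmx Ac; exact: (Ck_in_sub subi (W0 i)).
  by apply: Ck_inZ; [exact: Ck_in_cst|exact: (Ck_in_sub subj (Wh0 j))].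
have hae : {ae lebesgue_measure, forall s : R, s \in `[a, b] ->
    W s i *m A s + -1 *: Wh s j = 0}.
  apply: (ae_imply _ Wae) => s H sab; have sab' : a <= s <= b by move: sab; rewrite in_itv.
  rewrite H; last by have [] := sub s sab'.
  by rewrite (AP s sab' (W s)) scaleN1r subrr.
have := ae_eq0_within ab hc hae tab.
have tab' : a <= t <= b by move: tab; rewrite in_itv.
rewrite -(AP t tab' (W t)) scaleN1r => /eqP; rewrite subr_eq0 => /eqP E.
by apply: (tangent_eq xj).
Qed.

Context (hn : (2 <= n)%N) (qr : rolling tau q).
Context (yC : Ck_curve tau n y) (ya : arclength tau y) (yr : Ck_regular tau n.-1 y).
Context (yhC : Ck_curve tau n yh) (yha : arclength tau yh) (yhr : Ck_regular tau n.-1 yh).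

Lemma rolling_covariant (Z : forall t, tangent (y t)) (Zh : forall t, tangent (yh t)) :
  Ck_field tau 1 Z -> Ck_field tau 1 Zh ->
  (forall t, t \in `[0, tau] -> Zh t = iso_map (q t) (Z t)) ->
  forall t, t \in `[0, tau] -> covariant tau Zh t = iso_map (q t) (covariant tau Z t).
Proof.
move=> Z1 Zh1 ZE; have [qac _ qnt] := qr; apply: rolling_ae_eq => //.
- by apply: Ck_covariant => //; apply: Ck_curveW yC; exact: ltnW.
- by apply: Ck_covariant => //; apply: Ck_curveW yhC; exact: ltnW.
apply: (ae_imply _ (qnt Z (Ck_ac_field Z1))) => t H tI; rewrite H//.
(* The no-twist condition speaks of the image of [Z], which is [Zh] on the interval only. *)
by apply/val_inj/covariant_congr => // s sI; rewrite ZE.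
Qed.

Lemma rolling_frenet j : (j.+1 < n)%N -> forall t, t \in `[0, tau] ->
  [/\ (frenet tau yh j).2 t = iso_map (q t) ((frenet tau y j).2 t),
      (frenet tau yh j).1.2 t = iso_map (q t) ((frenet tau y j).1.2 t) &
      (frenet tau yh j).1.1 t = (frenet tau y j).1.1 t].
Proof.
have inorm t (v : tangent (y t)) : tnorm (iso_map (q t) v) = tnorm v.
  by rewrite /tnorm iso_map_inner.
elim: j => [|j IHj] jn t tI.
  split=> //=; last by rewrite linear0.
  have [qac qns _] := qr; apply: (rolling_ae_eq qac) qns _ tI.
  - by apply: Ck_velocity => //; apply: Ck_curveW yC; exact: ltnW.
  - by apply: Ck_velocity => //; apply: Ck_curveW yhC; exact: ltnW.
have jn' := ltnW jn.
have cE s : s \in `[0, tau] -> covariant tau (frenet tau yh j).2 s =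
    iso_map (q s) (covariant tau (frenet tau y j).2 s).
  apply: rolling_covariant; [exact: Ck_frenet|exact: Ck_frenet|].
  by move=> r rI; have [] := IHj jn' r rI.
have [eE pE kE] := IHj jn' t tI.
rewrite !frenetS/=; have -> : covariant tau (frenet tau yh j).2 t +
    (frenet tau yh j).1.1 t *: (frenet tau yh j).1.2 t =
    iso_map (q t) (covariant tau (frenet tau y j).2 t +
    (frenet tau y j).1.1 t *: (frenet tau y j).1.2 t).
  by rewrite linearD linearZ/= -cE// pE kE.
by rewrite inorm linearZ; split.
Qed.

Lemma rolling_curvature j t : (1 <= j <= n.-1)%N -> t \in `[0, tau] ->
  geodesic_curvature tau y j t = geodesic_curvature tau yh j t.
Proof.
move=> /andP[j1 jn] tI; rewrite /geodesic_curvature; case: ifP => jn1.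
  by have [_ _ ->] := rolling_frenet jn1 tI.
have n2 : (n.-2.+1 < n)%N by case: (n) hn => [|[|]].
have last_lt : (n.-1 < n)%N by case: (n) hn.
(* The last Frenet vector is not reached by differentiation. The isometry carries the frame to an
   orthonormal, positively oriented one with the same first [n - 1] vectors, and the completion is
   unique. *)
have lE : frenet_last tau yh t = iso_map (q t) (frenet_last tau y t).
  have [ob pb] := frenet_frameP hn htau yC ya yr tI.
  have [obh pbh] := frenet_frameP hn htau yhC yha yhr tI.
  have -> : frenet_last tau yh t = frenet_frame tau yh (Ordinal last_lt) t.
    by rewrite /frenet_frame /frenet_basis/= prednK ?ltnn//; case: (n) hn.
  have -> : frenet_last tau y t = frenet_frame tau y (Ordinal last_lt) t.
    by rewrite /frenet_frame /frenet_basis/= prednK ?ltnn//; case: (n) hn.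
  apply: (@orthonormal_last_unique _ _ _ _ (frenet_frame tau yh ^~ t)
    (iso_map (q t) \o (frenet_frame tau y ^~ t)) (Ordinal last_lt)) => //.
  - move=> k kl; have kn : (k.+1 < n)%N.
      move: kl; rewrite -(inj_eq val_inj)/=; have := ltn_ord k; lia.
    rewrite /= /frenet_frame /frenet_basis kn.
    by have [] := rolling_frenet kn tI.
  - by move=> k l; rewrite /= iso_map_inner.
  - exact: iso_map_oriented.
have cE := rolling_covariant (Ck_frenet hn htau yC yr n2) (Ck_frenet hn htau yhC yhr n2) _ tI.
have {cE} cE : covariant tau (frenet tau yh n.-2).2 t =
    iso_map (q t) (covariant tau (frenet tau y n.-2).2 t).
  by apply: cE => s sI; have [] := rolling_frenet n2 sI.
have [_ pE kE] := rolling_frenet n2 tI; move: cE pE kE.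
case: (frenet tau y n.-2) => [[k v] w].
case: (frenet tau yh n.-2) => [[k' v'] w'] /= -> -> ->.
by rewrite lE -linearZ -linearD iso_map_inner.
Qed.

End Forward.

(** * From frames with equal structure equations to a rolling *)

Section Backward.
Context (y : R -> M) (yh : R -> N).
Context (b : 'I_n -> forall t, tangent (y t)) (bh : 'I_n -> forall t, tangent (yh t)).
Context (om : 'I_n -> 'I_n -> R -> R) (l0 : 'I_n).
Context (yC : Ck_curve tau 1 y) (yhC : Ck_curve tau 1 yh).
Context (bP : forall t, orthonormal_family (b ^~ t) /\ positively_oriented (b ^~ t)).
Context (bhP : forall t, orthonormal_family (bh ^~ t) /\ positively_oriented (bh ^~ t)).
Context (b1 : forall k, Ck_field tau 1 (b k)) (bh1 : forall k, Ck_field tau 1 (bh k)).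

Let q t : configuration M N := frame_configuration (bP t) (bhP t).

Lemma frame_ac_configuration : ac_configuration_curve tau q.
Proof.
split; [exact: Ck_ac_curve|exact: Ck_ac_curve|].
move=> i j a c a0 ct dom.
exists (fun t => metric i (chart_map i (y t)) *m (frame_mx i (b ^~ t))^T *m
    frame_mx j (bh ^~ t)).
  by move=> t /dom[xi xj] v; exact: frame_iso_mx.
apply: (@C1_abs_continuous _ _ _ _ (chart_times tau y i `&` chart_times tau yh j)).
  move=> t tac; have [xi xj] := dom t tac; move: tac => /andP[at_ tc].
  have tI : t \in `[0, tau] by rewrite in_itv/= (le_trans a0 at_) (le_trans tc ct).
  by split; split.
apply: Ck_in_mulmx.
  apply: (@Ck_in_sub _ _ _ (chart_times tau y i)); first exact: subIsetl.
  apply: Ck_in_mulmx; first exact: Ck_metric yC.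
  apply: Ck_in_trmx; apply/Ck_in_mxP => k a'.
  have /Ck_in_mxP/(_ 0 a') := b1 k i.
  by apply: Ck_in_eq => t _; rewrite mxE.
apply: (@Ck_in_sub _ _ _ (chart_times tau yh j)); first exact: subIsetr.
apply/Ck_in_mxP => k a'; have /Ck_in_mxP/(_ 0 a') := bh1 k j.
by apply: Ck_in_eq => t _; rewrite mxE.
Qed.

Context (bD : forall k t, t \in `[0, tau] ->
  is_covariant tau (b k) (\sum_l om k l t *: b l t)).
Context (bhD : forall k t, t \in `[0, tau] ->
  is_covariant tau (bh k) (\sum_l om k l t *: bh l t)).

(* [Z] is covariantly differentiable iff its coordinates in the frame are
   differentiable, iff its image is covariantly differentiable; when it is not,
   both covariant derivatives have the junk value [0]. *)
Lemma frame_no_twist : no_twist tau q.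
Proof.
move=> Z _; apply: aeW => t tI; rewrite /q/=.
pose iZ s : tangent (yh s) := frame_iso (b ^~ s) (bh ^~ s) (Z s).
have iZb k s : inner (iZ s) (bh k s) = inner (Z s) (b k s).
  by apply: (frame_iso_coord (b ^~ s) (b' := bh ^~ s)); exact: (bhP s).1.
have fwd (w : tangent (y t)) : is_covariant tau Z w ->
    is_covariant tau iZ (frame_iso (b ^~ t) (bh ^~ t) w).
  move=> Zw.
  have fk k := is_deriv_inner yC.1 tI (velocityP htau yC tI) Zw (bD k tI).
  have wE := covariant_of_coords (fun s => (bP s).1) (bD ^~ t ^~ tI) fk.
  have fhk k : is_deriv_in `[0, tau] (fun s => inner (iZ s) (bh k s)) t
     (inner w (b k t) + inner (Z t) (\sum_l om k l t *: b l t)).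
    by apply: (deriv_in_eq _ tI (fk k)) => s _; rewrite iZb.
  have H := covariant_of_coords (fun s => (bhP s).1) (bhD ^~ t ^~ tI) fhk.
  have ww := is_covariant_unique htau tI Zw wE.
  suff -> : frame_iso (b ^~ t) (bh ^~ t) w = \sum_k
      ((inner w (b k t) + inner (Z t) (\sum_l om k l t *: b l t)) *: bh k t +
       inner (iZ t) (bh k t) *: (\sum_l om k l t *: bh l t)) by exact: H.
  (* The isometry sends [b k] to [bh k] and, as both frames share the matrix [om], the derivative of
     the former to that of the latter. *)
  apply: (eq_trans (congr1 (frame_iso (b ^~ t) (bh ^~ t)) ww)).
  rewrite linear_sum; apply: eq_bigr => k _; rewrite linearD !linearZ/= iZb.
  rewrite (frame_iso_basis (bh ^~ t) k (bP t).1); congr (_ + _ *: _).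
  rewrite linear_sum/=; apply: eq_bigr => l _; rewrite linearZ/=.
  by rewrite (frame_iso_basis (bh ^~ t) l (bP t).1).
have [[w Zw]|nZ] := pselect (exists w, is_covariant tau Z w (t := t)).
  by rewrite (covariantE htau tI Zw) (covariantE htau tI (fwd w Zw)).
have -> : covariant tau Z t = 0.
  by rewrite /covariant; case: xgetP => // w _ wP; case: nZ; exists w.
rewrite linear0 /covariant; case: xgetP => // wh _ whP; case: nZ.
have fhk k := is_deriv_inner yhC.1 tI (velocityP htau yhC tI) whP (bhD k tI).
have fk k : is_deriv_in `[0, tau] (fun s => inner (Z s) (b k s)) t
   (inner wh (bh k t) + inner (iZ t) (\sum_l om k l t *: bh l t)).
  by apply: (deriv_in_eq _ tI (fhk k)) => s _; rewrite -/(iZ s) iZb.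
by eexists; exact: (covariant_of_coords (fun s => (bP s).1) (bD ^~ t ^~ tI) fk).
Qed.

Lemma frame_rolling :
  (forall t, t \in `[0, tau] -> velocity tau y t = b l0 t) ->
  (forall t, t \in `[0, tau] -> velocity tau yh t = bh l0 t) ->
  rolling tau q.
Proof.
move=> yb yhb; split; [exact: frame_ac_configuration| |exact: frame_no_twist].
apply: aeW => t tI; rewrite /q/= yb// yhb//.
by rewrite (frame_iso_basis (bh ^~ t) l0 (bP t).1).
Qed.

End Backward.

End Rolling.

Theorem theorem2 (R : realType) (n : nat) (hn : (2 <= n)%N)
    (M Mhat : oriented_riemannian R n)
    (hM : connected [set: M]) (hMhat : connected [set: Mhat])
    (tau : R) (htau : 0 < tau) (x : R -> M) (xhat : R -> Mhat)
    (hxC : Ck_curve tau n x) (hxhatC : Ck_curve tau n xhat)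
    (hxa : arclength tau x) (hxhata : arclength tau xhat)
    (hxr : Ck_regular tau n.-1 x) (hxhatr : Ck_regular tau n.-1 xhat) :
  (exists q : R -> configuration M Mhat, rolling tau q /\
     forall t, t \in `[0, tau] -> base1 (q t) = x t /\ base2 (q t) = xhat t) <->
  (forall j : nat, (1 <= j <= n.-1)%N -> forall t, t \in `[0, tau] ->
     geodesic_curvature tau x j t = geodesic_curvature tau xhat j t).
Proof.
split=> [[q [qr qx]] j jn t tI|K].
  (* The base points of [q] are prescribed on the interval only, so the curvatures are first
     transferred to the curves of base points. *)
  have xq : curve_congr tau x (fun t => base1 (q t)) by move=> s /qx[].
  have xhq : curve_congr tau xhat (fun t => base2 (q t)) by move=> s /qx[].
  rewrite (geodesic_curvature_congr xq j tI) (geodesic_curvature_congr xhq j tI).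
  apply: rolling_curvature => //.
  - exact: Ck_curve_congr xq _ hxC.
  - exact: arclength_congr xq hxa.
  - exact: Ck_regular_congr xq _ hxr.
  - exact: Ck_curve_congr xhq _ hxhatC.
  - exact: arclength_congr xhq hxhata.
  - exact: Ck_regular_congr xhq _ hxhatr.
(* A configuration is needed at all times, also outside [[0, tau]]. *)
pose clamp (t : R) := Num.max 0 (Num.min t tau).
have clampI t : clamp t \in `[0, tau].
  by rewrite in_itv/= /clamp le_max lexx/= ge_max ge_min lexx orbT ltW.
have clamp_id t : t \in `[0, tau] -> clamp t = t.
  by rewrite in_itv/= => /andP[t0 tt]; rewrite /clamp min_l// max_r.
have x1 : Ck_curve tau 1 x by apply: Ck_curveW hxC; exact: ltnW.
have xh1 : Ck_curve tau 1 xhat by apply: Ck_curveW hxhatC; exact: ltnW.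
pose y t := x (clamp t); pose yh t := xhat (clamp t).
have xy : curve_congr tau x y by move=> t tI; rewrite /y clamp_id.
have xyh : curve_congr tau xhat yh by move=> t tI; rewrite /yh clamp_id.
pose b k t : tangent (y t) := frenet_frame tau x k (clamp t).
pose bh k t : tangent (yh t) := frenet_frame tau xhat k (clamp t).
(* The type of [Z t] depends on [t]; the clamped time is generalized so that the equation can be
   substituted everywhere at once. *)
have clamp_field (P : oriented_riemannian R n) (z : R -> P) (Z : forall t, tangent (z t)) :
    field_congr tau Z (fun t => Z (clamp t)).
  by move=> t tI; have : clamp t = t by [exact: clamp_id]; move: (clamp t) => s ->.
have bx k : field_congr tau (frenet_frame tau x k) (b k) by exact: clamp_field.
have bhx k : field_congr tau (frenet_frame tau xhat k) (bh k) by exact: clamp_field.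
have bP t := frenet_frameP hn htau hxC hxa hxr (clampI t).
have bhP t := frenet_frameP hn htau hxhatC hxhata hxhatr (clampI t).
exists (fun t => frame_configuration (bP t) (bhP t)); split; last first.
  by move=> t tI; rewrite /= clamp_id.
have n0 : (0 < n)%N by exact: ltnW.
(* The curvatures of [x] serve for both frames, and index 0 is v_1, the velocity. *)
apply: (@frame_rolling _ _ _ _ tau htau y yh b bh
  (fun k l t => frenet_matrix (geodesic_curvature tau x) k l t) (Ordinal n0)).
- exact: Ck_curve_congr xy _ x1.
- exact: Ck_curve_congr xyh _ xh1.
- by move=> k; apply: (Ck_field_congr xy (bx k)); exact: Ck_frenet_frame.
- by move=> k; apply: (Ck_field_congr xyh (bhx k)); exact: Ck_frenet_frame.
- move=> k t tI.
  apply: (is_covariant_congr xy (bx k) tI _ (frenet_frame_covariant hn htau hxC hxa hxr k tI)).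
  apply/funext => i; rewrite !tangent_sum; apply: eq_bigr => l _.
  by rewrite !tangentZ (bx l t tI).
- move=> k t tI.
  apply: (is_covariant_congr xyh (bhx k) tI _
    (frenet_frame_covariant hn htau hxhatC hxhata hxhatr k tI)).
  apply/funext => i; rewrite !tangent_sum; apply: eq_bigr => l _.
  rewrite !tangentZ (bhx l t tI); congr (_ *: _); rewrite /frenet_matrix.
  (* The nonzero entries involve only indices from 1 to [n - 1], the range in which the curvatures
     are assumed equal. *)
  have := ltn_ord k; have := ltn_ord l => ln kn.
  case: eqP => [lk|_]; first by rewrite K// lk; lia.
  by case: eqP => [kl|//]; rewrite K// kl; lia.
- move=> t tI; apply/val_inj; rewrite /= -(velocity_congr xy tI) -(bx (Ordinal n0) t tI).
  by rewrite frenet_frameE.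
- move=> t tI; apply/val_inj; rewrite /= -(velocity_congr xyh tI) -(bhx (Ordinal n0) t tI).
  by rewrite frenet_frameE.
Qed.
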